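(* Let $X$ be a real nonzero Banach space and $S,T:X\rightrightarrows X^*$ maximal monotone operators of Gossez type (D) with strong representative functions $h_S,h_T$ such that $\operatorname{pr}_{X^*}(\operatorname{dom}h_S)\cap\operatorname{pr}_{X^*}(\operatorname{dom}h_T)\neq\emptyset$. Assume one of: (a) $0\in{}^{ic}\big(\operatorname{pr}_{X^*}(\operatorname{dom}h_S)-\operatorname{pr}_{X^*}(\operatorname{dom}h_T)\big)$; (b) the set $\{(u^*,v^*,u^{**}+v^{**},r): r\in\mathbb R,\ h_S^*(u^*,u^{**})+h_T^*(v^*,v^{**})\le r\}$ is closed regarding $\Delta_{X^*}\times X^{**}\times\mathbb R$ in $(X^*,w^* )\times(X^*,w^* )\times(X^{**},w^* )\times\mathbb R$. Then: (i) $h:=\operatorname{cl}_{\|\cdot\|\times\|\cdot\|_*}(h_S\square_1h_T)$ is a strong representative function of $\overline S\|\overline T$, and $\overline S\|\overline T$ is maximal monotone of Gossez type (D); (ii) if $D(\overline S)\subseteq X$ (or $D(\overline T)\subseteq X$), then $h$ is a strong representative function of $S\|T$ and $S\|T$ is maximal monotone of Gossez type (D).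
   Context: $X$ identified with its image in $X^{**}$. $G,D$ denote graph and domain; $M^{-1}$ inverse operator. Coupling $c(x,x^* )=\langle x^*,x\rangle$. Conjugate of $h$ on $X\times X^*$: $h^*(x^*,x^{**})=\sup_{(x,y^* )}\{\langle x^*,x\rangle+\langle x^{**},y^*\rangle-h(x,y^* )\}$. Representative function of monotone $S$: convex norm-lsc $h_S$ with $h_S\ge c$ and $G(S)\subseteq\{h_S=c\}$; strong if $h_S^*(x^*,x^{**})\ge\langle x^{**},x^*\rangle$ for all. Gossez's closure $\overline S:X^{**}\rightrightarrows X^*$ has graph $\{(x^{**},x^* ):\langle x^{**}-y,x^*-y^*\rangle\ge0\ \forall(y,y^* )\in G(S)\}$; maximal monotone $S$ is of Gossez type (D) if each point of $G(\overline S)$ is the $w^*\times\|\cdot\|_*$-limit of a bounded net in $G(S)$. $(h_S\square_1h_T)(x,x^* )=\inf\{h_S(u,x^* )+h_T(w,x^* ):u,w\in X,\ u+w=x\}$. Parallel sums: $S\|T(x)=(S^{-1}+T^{-1})^{-1}(x)$ and $\overline S\|\overline T(x)=(\overline S^{-1}+\overline T^{-1})^{-1}(x)$ for $x\in X$. $\Delta_{X^*}=\{(x^*,x^* )\}$. Closed regarding $W$: $\operatorname{cl}D\cap W=D\cap W$. ${}^{ic}D=\operatorname{icr}D$ if $\operatorname{aff}D$ closed, else $\emptyset$, with $\operatorname{icr}D=\{u:\forall x\in\operatorname{aff}(D-D)\ \exists\delta>0\ \forall\lambda\in[0,\delta]:u+\lambda x\in D\}$. *)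

(* Defs.v *)
From HB Require Import structures.
From mathcomp Require Import all_boot all_order all_algebra.
From mathcomp Require Import all_classical all_reals all_analysis.
Set Implicit Arguments. Unset Strict Implicit. Unset Printing Implicit Defensive.
Import Order.TTheory GRing.Theory Num.Theory.
Import numFieldNormedType.Exports.
Local Open Scope classical_set_scope.
Local Open Scope ring_scope.

Section Duality.
Variables (R : realType) (X : normedModType R).

Definition dbound (f : X -> R) (K : R) := forall x : X, `|f x| <= K * `|x|.

Record dual := Dual {
  dval :> X -> R ;
  dval_lin : forall (t : R) (x y : X), dval (t *: x + y) = t * dval x + dval y ;
  dval_bnd : exists K : R, dbound dval K }.

Record bidual := Bidual {
  bval :> dual -> R ;
  bval_lin : forall (t : R) (f g h : dual),
      (forall x, h x = t * f x + g x) -> bval h = t * bval f + bval g ;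
  bval_bnd : exists M : R, forall (f : dual) (K : R),
      0 <= K -> dbound f K -> `|bval f| <= M * K }.

Definition is_canon (F : bidual) (x : X) := forall f : dual, F f = f x.

Definition coupling (z : X * dual) : R := z.2 z.1.

Definition nclose (z w : X * dual) (e : R) :=
  `|z.1 - w.1| < e /\ exists K, K < e /\ dbound (fun x => z.2 x - w.2 x) K.

Definition nlsc (h : X * dual -> \bar R) :=
  forall z (r : R), (r%:E < h z)%E ->
    exists e, 0 < e /\ forall w, nclose z w e -> (r%:E < h w)%E.

Definition convex_fun (h : X * dual -> \bar R) :=
  forall (z1 z2 z : X * dual) (t : R), 0 < t < 1 ->
    z.1 = t *: z1.1 + (1 - t) *: z2.1 ->
    (forall x, z.2 x = t * z1.2 x + (1 - t) * z2.2 x) ->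
    (h z <= t%:E * h z1 + (1 - t)%:E * h z2)%E.

(* cl_{||.|| x ||.||_*} h : the function whose epigraph is the norm closure
   of the epigraph of h *)
Definition nclosure (h : X * dual -> \bar R) (z : X * dual) : \bar R :=
  ereal_inf [set r%:E | r in [set r : R | forall e, 0 < e ->
     exists w, nclose z w e /\ (h w < (r + e)%:E)%E]].

Definition conj_fun (h : X * dual -> \bar R) (a : dual) (F : bidual) : \bar R :=
  ereal_sup [set ((a z.1 + F z.2)%:E - h z)%E | z in [set: X * dual]].

(* operators X =>> X^* are given by their graphs *)
Definition monotone (G : set (X * dual)) :=
  forall z w : X * dual, G z -> G w -> 0 <= z.2 z.1 - z.2 w.1 - w.2 z.1 + w.2 w.1.

Definition maximal_monotone (G : set (X * dual)) :=
  monotone G /\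
  forall z : X * dual, (forall w : X * dual, G w -> 0 <= z.2 z.1 - z.2 w.1 - w.2 z.1 + w.2 w.1) -> G z.

Definition gossez (G : set (X * dual)) : set (bidual * dual) :=
  [set p : bidual * dual | forall w : X * dual, G w -> 0 <= p.1 p.2 - p.1 w.2 - p.2 w.1 + w.2 w.1].

Definition gossez_D (G : set (X * dual)) :=
  maximal_monotone G /\
  forall p, gossez G p ->
    exists (I : Type) (le : I -> I -> Prop) (net : I -> X * dual),
      (exists i : I, True) /\
      (forall i, le i i) /\
      (forall i j k, le i j -> le j k -> le i k) /\
      (forall i j, exists k, le i k /\ le j k) /\
      (forall i, G (net i)) /\
      (exists M : R, forall i, `|(net i).1| <= M /\ dbound (net i).2 M) /\
      (forall (n : nat) (fs : 'I_n -> dual) (e : R), 0 < e ->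
         exists i0, forall i, le i0 i ->
           (forall k, `|fs k (net i).1 - p.1 (fs k)| < e) /\
           exists K, K < e /\ dbound (fun x => (net i).2 x - p.2 x) K).

Definition representative (G : set (X * dual)) (h : X * dual -> \bar R) :=
  [/\ convex_fun h, nlsc h,
      (forall z, ((coupling z)%:E <= h z)%E) &
      (forall z, G z -> h z = (coupling z)%:E)].

Definition strong_representative (G : set (X * dual)) (h : X * dual -> \bar R) :=
  representative G h /\ forall (a : dual) (F : bidual), ((F a)%:E <= conj_fun h a F)%E.

Definition pr_dual_dom (h : X * dual -> \bar R) : set dual :=
  [set a | exists x, (h (x, a) < +oo)%E].

Definition infconv1 (hS hT : X * dual -> \bar R) (z : X * dual) : \bar R :=
  ereal_inf [set v | exists u w : X,
     u + w = z.1 /\ v = (hS (u, z.2) + hT (w, z.2))%E].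

Definition par_sum (GS GT : set (X * dual)) : set (X * dual) :=
  [set z | exists u w, u + w = z.1 /\ GS (u, z.2) /\ GT (w, z.2)].

Definition bar_par_sum (GS GT : set (X * dual)) : set (X * dual) :=
  [set z | exists U W : bidual,
     (forall f : dual, U f + W f = f z.1) /\
     gossez GS (U, z.2) /\ gossez GT (W, z.2)].

Definition gossez_dom_in_X (G : set (X * dual)) :=
  forall p, gossez G p -> exists x, is_canon p.1 x.

Definition dset_diff (A B : set dual) : set (X -> R) :=
  [set f | exists a b, A a /\ B b /\ f = (fun x => a x - b x)].

Definition fset_diff (A B : set (X -> R)) : set (X -> R) :=
  [set f | exists a b, A a /\ B b /\ f = (fun x => a x - b x)].

Definition aff (D : set (X -> R)) : set (X -> R) :=
  [set f | exists (n : nat) (c : 'I_n -> R) (d : 'I_n -> X -> R),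
     \sum_(i < n) c i = 1 /\ (forall i, D (d i)) /\
     f = (fun x => \sum_(i < n) c i * d i x)].

Definition dclosed (D : set (X -> R)) :=
  forall g : dual, (forall e, 0 < e -> exists f, D f /\
      exists K, K < e /\ dbound (fun x => g x - f x) K) -> D g.

Definition icr (D : set (X -> R)) : set (X -> R) :=
  [set u | forall y, aff (fset_diff D D) y ->
     exists d, 0 < d /\ forall l, 0 <= l <= d -> D (fun x => u x + l * y x)].

Definition ic (D : set (X -> R)) : set (X -> R) :=
  [set u | dclosed (aff D) /\ icr D u].

Definition wstar_closure (E : set (dual * dual * bidual * R)) :
    set (dual * dual * bidual * R) :=
  [set p : dual * dual * bidual * R | forall (n : nat) (xs : 'I_n -> X) (fs : 'I_n -> dual) (e : R), 0 < e ->
     exists q : dual * dual * bidual * R, E q /\ (forall k,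
        `|p.1.1.1 (xs k) - q.1.1.1 (xs k)| < e /\
        `|p.1.1.2 (xs k) - q.1.1.2 (xs k)| < e /\
        `|p.1.2 (fs k) - q.1.2 (fs k)| < e) /\ `|p.2 - q.2| < e].

Definition closed_regarding (E W : set (dual * dual * bidual * R)) :=
  wstar_closure E `&` W = E `&` W.

Definition condb_set (hS hT : X * dual -> \bar R) : set (dual * dual * bidual * R) :=
  [set p : dual * dual * bidual * R | exists U V : bidual, (forall f, p.1.2 f = U f + V f) /\
     (conj_fun hS p.1.1.1 U + conj_fun hT p.1.1.2 V <= p.2%:E)%E].

Definition diag_set : set (dual * dual * bidual * R) :=
  [set p : dual * dual * bidual * R | forall x, p.1.1.1 x = p.1.1.2 x].

End Duality.

(* Main.v *)
(* Everything rests on one sandwich theorem (Hahn-Banach with a convex bound). If h is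
   convex, norm-lsc, h >= c and h^* >= c, it gives, at every point of X x X^*, infimum
   at most 0 for h recentred there plus a quadratic penalty; iterating this statement is
   a Brøndsted-Rockafellar argument, so {h = c} is maximal monotone. Giving the two
   factors unequal penalty weights shows that {h = c} is of negative infimum type in
   X^** x X^*, and then the sandwich theorem applied to the convex hull of the graph of c
   over {h = c}, with Goldstine's theorem, produces the bounded nets of type (D).
   For h = cl (h_S [] h_T), each of (a) and (b) makes the conjugate of the infimal
   convolution split as h_S^*(a, U) + h_T^*(a, V): under (b) by separating in finitely
   many coordinates, under (a) by Baire's theorem and an open mapping argument on the
   span of the difference of the projected domains. Splitting yields h^* >= c and
   places {h = c} inside the extended parallel sum; the latter is monotone because S and
   T are of type (D), so both sets coincide by maximality. *)
Require Import Defs.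
From HB Require Import structures.
From mathcomp Require Import all_boot all_order all_algebra.
From mathcomp Require Import all_classical all_reals all_analysis.
From mathcomp Require Import ring lra.
Set Implicit Arguments. Unset Strict Implicit. Unset Printing Implicit Defensive.
Import Order.TTheory GRing.Theory Num.Theory.
Import numFieldNormedType.Exports.
Local Open Scope classical_set_scope.
Local Open Scope ring_scope.

(** Without reflexivity, infima over X x X^* need not be attained, so every extremal statement
    carries an error [e] and exact points come only from completeness. The penalty s/2 |x|^2 +
    |x^*|^2 / (2s) is chosen because its two parts are conjugate to each other: for every s > 0 it
    is at least minus the coupling, and its dual counterpart has the same form, so one argument
    serves all weights. Sandwiching against a convex function that is finite everywhere requires no
    qualification condition, and local boundedness of that function makes the resulting functional
    continuous, hence a pair in X^* x X^**. Conditions (a) and (b) meet only in [conj_split]. Sums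
    of conjugates are mostly handled as inequalities between real points of epigraphs, where
    infinities cannot cancel. *)

(** * Hahn-Banach theorem with a convex bound, sandwich and separation *)

Section ConvexSeparation.
Variable R : realType.

Definition cvx_set (V : lmodType R) (A : set V) :=
  forall (x y : V) (t : R), A x -> A y -> 0 < t < 1 -> A (t *: x + (1 - t) *: y).

Definition cvx_fun (V : lmodType R) (q : V -> R) :=
  forall (x y : V) (t : R), 0 < t < 1 -> q (t *: x + (1 - t) *: y) <= t * q x + (1 - t) * q y.

Definition lin_fun (V : lmodType R) (l : V -> R) :=
  forall (t : R) (x y : V), l (t *: x + y) = t * l x + l y.

Section LinFun.
Variables (V : lmodType R) (l : V -> R).
Hypothesis ll : lin_fun l.

Lemma lin0 : l 0 = 0.
Proof. by have := ll 1 0 0; rewrite scale1r addr0 mul1r; lra. Qed.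
Lemma linD x y : l (x + y) = l x + l y.
Proof. by have := ll 1 x y; rewrite scale1r mul1r. Qed.
Lemma linZ t x : l (t *: x) = t * l x.
Proof. by have := ll t x 0; rewrite addr0 lin0 addr0. Qed.
Lemma linN x : l (- x) = - l x.
Proof. by rewrite -scaleN1r linZ mulN1r. Qed.
Lemma linB x y : l (x - y) = l x - l y.
Proof. by rewrite linD linN. Qed.
Lemma lin_sum (I : finType) (c : I -> R) (v : I -> V) :
  l (\sum_i c i *: v i) = \sum_i c i * l (v i).
Proof.
rewrite (big_morph l linD lin0); apply: eq_bigr => i _; exact: linZ.
Qed.
End LinFun.

Section HahnBanach.
Variables (V : lmodType R) (p : V -> R).
Hypotheses (pc : cvx_fun p) (p0 : 0 <= p 0).

(** Partial linear functionals as graphs. Single-valuedness follows from the bound: a graph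
    containing [(0, d)] with [d] nonzero would contain all its multiples, which [p 0] cannot
    dominate. *)
Let Pg : set (set (V * R)) := [set G | G (0, 0) /\
  (forall t v r w s, G (v, r) -> G (w, s) -> G (t *: v + w, t * r + s)) /\
  (forall v r, G (v, r) -> r <= p v)].

(** The weights s/(s+t) and t/(s+t) cancel the direction [v0], so convexity compares both slopes
    with a point of the domain of [G]. Every lower slope is thus below every upper one, and a value
    at [v0] fits between them. *)
Let Pg_lt G v0 v r v' r' s t : Pg G -> G (v, r) -> G (v', r') -> 0 < s -> 0 < t ->
  (r' - p (v' - s *: v0)) / s <= (p (v + t *: v0) - r) / t.
Proof.
move=> [G0 [Gl Gp]] Gv Gv' s0 t0.
have st0 : 0 < s + t by lra.
have stN : s + t != 0 by rewrite gt_eqF.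
set a := s / (s + t).
have a01 : 0 < a < 1 by rewrite divr_gt0//= ltr_pdivrMr// mul1r; lra.
have b1 : 1 - a = t / (s + t) by rewrite /a; field.
have := pc (v + t *: v0) (v' - s *: v0) a01.
have -> : a *: (v + t *: v0) + (1 - a) *: (v' - s *: v0) = a *: v + ((1 - a) *: v' + 0).
  rewrite addr0 b1 /a !scalerDr scalerN !scalerA addrACA.
  by rewrite (_ : t / (s + t) * s = s / (s + t) * t) ?subrr ?addr0//; field.
move=> H; have H2 := Gp _ _ (Gl a _ _ _ _ Gv (Gl (1 - a) _ _ _ _ Gv' G0)).
have := le_trans H2 H; rewrite addr0 => H3.
rewrite ler_pdivrMr// mulrAC ler_pdivlMr//.
move: H3; rewrite b1 /a !(mulrAC _ (s + t)^-1) -!mulrDl ler_pM2r ?invr_gt0//; lra.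
Qed.

Lemma hahn_banach_cvx : exists l : V -> R, lin_fun l /\ forall v, l v <= p v.
Proof.
(* The alternative [G = set0] admits the union of the empty chain. *)
have [F FP Ftot|G [GP Gmax]] := @Zorn_bigcup (V * R)%type (fun G => Pg G \/ G = set0).
  have [[G0 [FG0 G0P]]|Fn] := pselect (exists G, F G /\ Pg G); last first.
    right; rewrite -subset0 => x [G FG Gx].
    have [GP|GE] := FP _ FG; first by apply: Fn; exists G.
    by move: Gx; rewrite GE.
  left; split; [|split].
  - by exists G0 => //; exact: G0P.1.
  - move=> t v r w s [A FA Av] [B FB Bw].
    have [AB|BA] := Ftot _ _ FA FB.
      exists B => //; have [BP|BE] := FP _ FB; last by move: Bw; rewrite BE.
      by apply: BP.2.1 => //; exact: AB.
    exists A => //; have [AP|AE] := FP _ FA; last by move: Av; rewrite AE.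
    by apply: AP.2.1 => //; exact: BA.
  - move=> v r [A FA Av]; have [AP|AE] := FP _ FA; last by move: Av; rewrite AE.
    exact: AP.2.2.
have Pg0 : Pg [set (0, 0)].
  split=> //; split => [t v r w s [-> ->] [-> ->]|v r [-> ->]]; last exact: p0.
  by rewrite scaler0 mulr0 !addr0.
have {}GP : Pg G.
  case: GP => // GE; exfalso; apply: (Gmax [set (0, 0)]); last by left.
  rewrite GE; split; first exact: sub0set.
  by move=> /(_ (0, 0) erefl).
have [G0 [Gl Gp]] := GP.
have Gfun v r r' : G (v, r) -> G (v, r') -> r = r'.
  move=> Gr Gr'; apply/eqP; rewrite -subr_eq0; apply/eqP; set d := r - r'.
  have Gd : G (0, d).
    by have := Gl (-1) _ _ _ _ Gr' Gr; rewrite scaleN1r addNr mulN1r addrC.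
  have Gtd t : t * d <= p 0.
    by have := Gp _ _ (Gl t _ _ _ _ Gd G0); rewrite scaler0 !addr0.
  apply/eqP/negP => dN; have := Gtd ((p 0 + 1) / d).
  by rewrite -mulrA mulVf ?mulr1; [lra|exact/negP].
have Gtot v0 : exists r, G (v0, r).
  apply: contrapT => /forallNP Nv0.
  pose Lo := [set x | exists v' r' s, [/\ G (v', r'), 0 < s & x = (r' - p (v' - s *: v0)) / s]].
  have LoN : Lo !=set0.
    exists ((0 - p (0 - 1 *: v0)) / 1); rewrite /Lo/=; exists 0, 0, 1.
    by split=> //; exact: ltr01.
  have LoU v r t : G (v, r) -> 0 < t -> ubound Lo ((p (v + t *: v0) - r) / t).
    by move=> Gv t0 _ [v' [r' [s [Gv' s0 ->]]]]; exact: (Pg_lt _ GP Gv Gv' s0 t0).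
  pose c := sup Lo.
  have c_le v r t : G (v, r) -> 0 < t -> c <= (p (v + t *: v0) - r) / t.
    by move=> Gv t0; apply: ge_sup => //; exact: LoU.
  have c_ge v r s : G (v, r) -> 0 < s -> (r - p (v - s *: v0)) / s <= c.
    move=> Gv s0; apply: sup_upper_bound; last by exists v, r, s.
    split=> //; exists ((p (0 + 1 *: v0) - 0) / 1); exact: LoU.
  pose G' := [set x : V * R | exists v r t, [/\ G (v, r), x.1 = v + t *: v0 & x.2 = r + t * c]].
  have GG' : G `<=` G'.
    by move=> [v r] Gv; exists v, r, 0; rewrite /= scale0r mul0r !addr0.
  apply: (Gmax G').
    split => // G'G; apply: (Nv0 c); apply: G'G; exists 0, 0, 1; split=> //=.
      by rewrite scale1r add0r.
    by rewrite mul1r add0r.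
  left; split; first exact: GG'.
  split.
    move=> t v r w s [v1 [r1 [t1 [G1 /= -> ->]]]] [v2 [r2 [t2 [G2 /= -> ->]]]].
    exists (t *: v1 + v2), (t * r1 + r2), (t * t1 + t2); split; first exact: Gl.
      by rewrite /= scalerDr scalerDl scalerA addrACA.
    by rewrite /=; ring.
  move=> _ _ [v [r [t [Gv /= -> ->]]]].
  have [t0|t0|->] := ltgtP t 0; last by rewrite scale0r mul0r !addr0; exact: Gp.
    have t0' : 0 < - t by lra.
    have := c_ge _ _ _ Gv t0'; rewrite ler_pdivrMr// scaleNr opprK; lra.
  have := c_le _ _ _ Gv t0; rewrite ler_pdivlMr//; lra.
pose l v := sval (cid (Gtot v)).
have lP v : G (v, l v) by rewrite /l; case: cid.
exists l; split => [t x y|v]; last exact: Gp.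
by apply: (Gfun (t *: x + y)) => //; exact: Gl.
Qed.
End HahnBanach.

(** Hahn-Banach is applied to p(v) = inf over z in [A] of z.2 + q(z.1 - v) - m. The assumption says
    p(0) >= 0, and a linear minorant of [p] at v = z.1 - w is the conclusion. *)
Lemma sandwich (V : lmodType R) (A : set (V * R)) (q : V -> R) (m : R) :
  cvx_set A -> cvx_fun q -> (forall z, A z -> m <= z.2 + q z.1) ->
  exists l : V -> R, lin_fun l /\
    forall z w, A z -> m + l (z.1 - w) <= z.2 + q w.
Proof.
move=> Ac qc Am.
have [[z0 Az0]|A0] := pselect (A !=set0); last first.
  exists (fun=> 0); split=> [t x y|z w Az]; first by rewrite mulr0 addr0.
  by case: A0; exists z.
pose B v := [set z.2 + q (z.1 - v) - m | z in A].
have h2 : 0 < (2^-1 : R) < 1 by lra.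
have h1 : 1 - 2^-1 = 2^-1 :> R by lra.
(* Finiteness of [p]: the points z.1 - v and z0.1 + v have the same midpoint as z.1 and z0.1, where
   the hypothesis on [A] applies. *)
have Blb v : lbound (B v) (m - z0.2 - q (z0.1 + v)).
  move=> _ [z Az <-].
  have := Am _ (Ac _ _ _ Az Az0 h2); rewrite h1 /=.
  have := qc (z.1 - v) (z0.1 + v) _ h2; rewrite h1.
  rewrite (_ : 2^-1 *: (z.1 - v) + 2^-1 *: (z0.1 + v) = 2^-1 *: z.1 + 2^-1 *: z0.1); last first.
    by rewrite -!scalerDr addrACA addNr addr0.
  rewrite /GRing.scale/=; lra.
have BN v : B v !=set0 by exists (z0.2 + q (z0.1 - v) - m); exists z0.
pose p v := inf (B v).
have p_le v z : A z -> p v <= z.2 + q (z.1 - v) - m.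
  by move=> Az; apply: inf_lbound; [exists (m - z0.2 - q (z0.1 + v)); exact: Blb|exists z].
have p_adh v e : 0 < e -> exists2 z, A z & z.2 + q (z.1 - v) - m < p v + e.
  move=> e0; have [|_ [z Az <-] zlt] := @inf_adherent _ (B v) e e0; last by exists z.
  by split => //; exists (m - z0.2 - q (z0.1 + v)); exact: Blb.
have pc : cvx_fun p.
  move=> x y t t01; apply/ler_addgt0Pr => e e0.
  have [z1 Az1 Hz1] := p_adh x _ e0; have [z2 Az2 Hz2] := p_adh y _ e0.
  apply: (le_trans (p_le _ _ (Ac _ _ _ Az1 Az2 t01))) => /=.
  have := qc (z1.1 - x) (z2.1 - y) _ t01.
  rewrite (_ : t *: (z1.1 - x) + (1 - t) *: (z2.1 - y) =
     t *: z1.1 + (1 - t) *: z2.1 - (t *: x + (1 - t) *: y)); last first.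
    by rewrite !scalerBr opprD addrACA.
  rewrite /GRing.scale/=.
  case/andP: t01 => t0 t1; move: Hz1 Hz2.
  set a1 := q _; set a2 := q (z2.1 - y); set a3 := q _ => Hz1 Hz2 Ha.
  have : t * (z1.2 + a1 - m) <= t * (p x + e) by rewrite ler_pM2l// ltW.
  have : (1 - t) * (z2.2 + a2 - m) <= (1 - t) * (p y + e) by rewrite ler_pM2l ?subr_gt0// ltW.
  nra.
have p0 : 0 <= p 0.
  apply: lb_le_inf => // _ [z Az <-]; rewrite subr0 subr_ge0; exact: Am.
have [l [ll lp]] := hahn_banach_cvx pc p0.
exists l; split=> // z w Az.
have := le_trans (lp (z.1 - w)) (p_le (z.1 - w) z Az).
rewrite opprB addrCA subrr addr0; lra.
Qed.

(** Sandwich with [A] placed at height 0 and the l1 distance to [p] as convex function; that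
    distance dominates each coordinate distance, so it is at least [e] on [A]. *)
Lemma finite_separation (I : finType) (A : set (I -> R)) (p : I -> R) (e : R) :
  0 < e -> (forall x y (t : R), A x -> A y -> 0 < t < 1 -> A (fun i => t * x i + (1 - t) * y i)) ->
  (forall v, A v -> exists i, e <= `|v i - p i|) ->
  exists c : I -> R, forall v, A v -> \sum_i c i * v i <= \sum_i c i * p i - e.
Proof.
move=> e0 Ac Ap.
pose A' : set ((I -> R) * R) := [set z | A z.1 /\ z.2 = 0].
pose q (v : I -> R) : R := \sum_i `|v i - p i|.
have [||/= z [Az ->]|l [ll lP]] := @sandwich _ A' q e.
- move=> x y t [Ax x2] [Ay y2] t01; split; first exact: (Ac x.1 y.1).
  by rewrite /= x2 y2 !scaler0 addr0.
- move=> x y t /andP[t0 t1]; rewrite /q !mulr_sumr -big_split/=.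
  apply: ler_sum => i _.
  have -> : (t *: x + (1 - t) *: y) i - p i = t * (x i - p i) + (1 - t) * (y i - p i).
    transitivity (t * x i + (1 - t) * y i - p i); first by [].
    by ring.
  apply: (le_trans (ler_normD _ _)); rewrite !normrM (gtr0_norm t0) (@gtr0_norm _ (1 - t)) ?subr_gt0// lexx.
- rewrite add0r; have [i ei] := Ap _ Az; rewrite /q (bigD1 i)//=.
  by apply: (le_trans ei); rewrite lerDl; apply: sumr_ge0.
pose d i : I -> R := fun j => (i == j)%:R.
have lE v : l v = \sum_i l (d i) * v i.
  have {1}-> : v = \sum_i v i *: d i.
    apply/funext => j; rewrite fct_sumE (bigD1 j)//= big1 ?addr0 => [|i ij].
      by rewrite [RHS](_ : _ = v j * d j j)// /d eqxx mulr1.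
    by rewrite [LHS](_ : _ = v i * d i j)// /d (negbTE ij) mulr0.
  by rewrite lin_sum//; apply: eq_bigr => i _; rewrite mulrC.
exists (fun i => l (d i)) => v Av; rewrite -!lE.
have := lP (v, 0) p (conj Av erefl); rewrite linB//= /q big1 => [|i _]; first lra.
by rewrite subrr normr0.
Qed.
End ConvexSeparation.

(** * The dual as a normed space; functionals on it *)

Section DualNormed.
Variables (R : realType) (X : normedModType R).
Local Notation D := (dual X).

Lemma dual_ext (f g : D) : (forall x, f x = g x) -> f = g.
Proof.
case: f g => [f fl fb] [g gl gb] /= /funext fg; subst g.
by rewrite (Prop_irrelevance fl gl) (Prop_irrelevance fb gb).
Qed.

HB.instance Definition _ := gen_eqMixin (dual X).
HB.instance Definition _ := gen_choiceMixin (dual X).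

Lemma dual_bound_ex (f : D) : exists2 K, 0 <= K & dbound f K.
Proof.
have [K fK] := dval_bnd f; exists `|K| => // x.
by apply: (le_trans (fK x)); apply: ler_wpM2r => //; exact: ler_norm.
Qed.

Let dual0_lin : lin_fun (fun _ : X => 0 : R).
Proof. by move=> t x y; rewrite mulr0 addr0. Qed.
Let dual0_bnd : exists K, dbound (fun _ : X => 0 : R) K.
Proof. by exists 0 => x; rewrite normr0 mul0r. Qed.
Definition dual0 : D := Dual dual0_lin dual0_bnd.

Let dualD_lin (f g : D) : lin_fun (fun x => f x + g x).
Proof. by move=> t x y; rewrite !dval_lin mulrDr addrACA. Qed.
Let dualD_bnd (f g : D) : exists K, dbound (fun x => f x + g x) K.
Proof.
have [K _ fK] := dual_bound_ex f; have [L _ gL] := dual_bound_ex g.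
exists (K + L) => x; rewrite mulrDl; exact: le_trans (ler_normD _ _) (lerD (fK x) (gL x)).
Qed.
Definition dualD (f g : D) : D := Dual (@dualD_lin f g) (dualD_bnd f g).

Let dualZ_lin (a : R) (f : D) : lin_fun (fun x => a * f x).
Proof. by move=> t x y; rewrite !dval_lin; ring. Qed.
Let dualZ_bnd (a : R) (f : D) : exists K, dbound (fun x => a * f x) K.
Proof.
have [K _ fK] := dual_bound_ex f; exists (`|a| * K) => x.
by rewrite normrM -mulrA ler_wpM2l.
Qed.
Definition dualZ (a : R) (f : D) : D := Dual (@dualZ_lin a f) (dualZ_bnd a f).

Let dualDA : associative dualD.
Proof. by move=> f g h; apply: dual_ext => x /=; rewrite addrA. Qed.
Let dualDC : commutative dualD.
Proof. by move=> f g; apply: dual_ext => x /=; rewrite addrC. Qed.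
Let dual0D : left_id dual0 dualD.
Proof. by move=> f; apply: dual_ext => x /=; rewrite add0r. Qed.
Let dualND : left_inverse dual0 (dualZ (-1)) dualD.
Proof. by move=> f; apply: dual_ext => x /=; rewrite mulN1r addNr. Qed.
HB.instance Definition _ := GRing.isZmodule.Build (dual X) dualDA dualDC dual0D dualND.

Let dualZA a b (f : D) : dualZ a (dualZ b f) = dualZ (a * b) f.
Proof. by apply: dual_ext => x /=; rewrite mulrA. Qed.
Let dual1Z : left_id 1 dualZ.
Proof. by move=> f; apply: dual_ext => x /=; rewrite mul1r. Qed.
Let dualZDr : right_distributive dualZ +%R.
Proof. by move=> a f g; apply: dual_ext => x /=; rewrite mulrDr. Qed.
Let dualZDl (f : D) : {morph dualZ^~ f : a b / a + b >-> a + b}.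
Proof. by move=> a b; apply: dual_ext => x /=; rewrite mulrDl. Qed.
HB.instance Definition _ := GRing.Zmodule_isLmodule.Build R (dual X) dualZA dual1Z dualZDr dualZDl.

Lemma dual0E (x : X) : (0 : D) x = 0. Proof. by []. Qed.
Lemma dualDE (f g : D) x : (f + g) x = f x + g x. Proof. by []. Qed.
Lemma dualZE a (f : D) x : (a *: f) x = a * f x. Proof. by []. Qed.
Lemma dualNE (f : D) x : (- f) x = - f x. Proof. exact: mulN1r. Qed.
Lemma dualBE (f g : D) x : (f - g) x = f x - g x.
Proof. by rewrite dualDE dualNE. Qed.

Definition dnorm (f : D) : R := inf [set K | 0 <= K /\ dbound f K].

Let dnorm_has_inf (f : D) : has_inf [set K | 0 <= K /\ dbound f K].
Proof.
split; last by exists 0 => K [].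
by have [K K0 fK] := dual_bound_ex f; exists K.
Qed.

Let dnorm_min (f : D) K : 0 <= K -> dbound f K -> dnorm f <= K.
Proof. by move=> K0 fK; apply: (inf_lbound (dnorm_has_inf f).2). Qed.

Let dnorm_ge0 (f : D) : 0 <= dnorm f.
Proof. by apply: lb_le_inf => [|K []//]; exact: (dnorm_has_inf f).1. Qed.

Let dnorm_bound (f : D) : dbound f (dnorm f).
Proof.
move=> x; have [->|x0] := eqVneq x 0.
  by rewrite (lin0 (dval_lin f)) !normr0 mulr0.
rewrite -ler_pdivrMr ?normr_gt0//; apply: lb_le_inf; first exact: (dnorm_has_inf f).1.
by move=> K [_ fK]; rewrite ler_pdivrMr ?normr_gt0.
Qed.

Let dnormD (f g : D) : dnorm (f + g) <= dnorm f + dnorm g.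
Proof.
apply: dnorm_min => [|x]; first by rewrite addr_ge0.
rewrite mulrDl; exact: le_trans (ler_normD _ _) (lerD (dnorm_bound f x) (dnorm_bound g x)).
Qed.

Let dnormZ_le a (f : D) : dnorm (a *: f) <= `|a| * dnorm f.
Proof.
apply: dnorm_min => [|x]; first by rewrite mulr_ge0.
by rewrite dualZE normrM -mulrA ler_wpM2l// dnorm_bound.
Qed.

Let dnormZ a (f : D) : dnorm (a *: f) = `|a| * dnorm f.
Proof.
apply/eqP; rewrite eq_le dnormZ_le/=; have [->|a0] := eqVneq a 0.
  by rewrite normr0 mul0r.
have := dnormZ_le a^-1 (a *: f); rewrite scalerA mulVf// scale1r normfV.
by rewrite ler_pdivlMl ?normr_gt0.
Qed.

Let dnorm_eq0 (f : D) : dnorm f = 0 -> f = 0.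
Proof.
move=> f0; apply: dual_ext => x; apply/eqP; rewrite -normr_le0.
by have := dnorm_bound f x; rewrite f0 mul0r.
Qed.

HB.instance Definition _ := Lmodule_isNormed.Build R (dual X) dnormD dnormZ dnorm_eq0.

Lemma dual_norm_le (f : D) K : 0 <= K -> dbound f K -> `|f| <= K.
Proof. exact: dnorm_min. Qed.

Lemma dual_bound (f : D) x : `|f x| <= `|f| * `|x|.
Proof. exact: dnorm_bound. Qed.

Lemma dual_ge (f : D) x : - (`|f| * `|x|) <= f x.
Proof. by have := dual_bound f x; rewrite ler_norml => /andP[]. Qed.

Lemma ncloseP (z w : X * D) e :
  nclose z w e <-> `|z.1 - w.1| < e /\ `|z.2 - w.2| < e.
Proof.
split=> [[z1 [K [Ke zK]]]|[z1 z2]].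
  have e0 : 0 < e by exact: le_lt_trans z1.
  (* On the zero space [dbound] holds with a negative [K], hence the maximum. *)
  split=> //; have : `|z.2 - w.2| <= Num.max 0 K.
    apply: dual_norm_le => [|x]; first by rewrite le_max lexx.
    rewrite dualBE; apply: (le_trans (zK x)).
    by rewrite ler_wpM2r// le_max lexx orbT.
  by move/le_lt_trans; apply; rewrite gt_max e0.
split=> //; exists `|z.2 - w.2|; split=> // x.
by rewrite -dualBE; exact: dual_bound.
Qed.

Lemma bidual_lin (F : bidual X) : lin_fun F.
Proof. by move=> t f g; exact: bval_lin. Qed.

Lemma bidual_bound (F : bidual X) : exists2 M, 0 < M & forall f, `|F f| <= M * `|f|.
Proof.
have [M FM] := bval_bnd F; exists (`|M| + 1) => [|f]; first by rewrite ltr_pwDr.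
apply: (le_trans (FM f `|f| (normr_ge0 _) (dual_bound f))).
by rewrite ler_wpM2r//; apply: (le_trans (ler_norm _)); rewrite lerDl.
Qed.

Lemma bidual_of (l : D -> R) (M : R) : lin_fun l -> (forall f, `|l f| <= M * `|f|) ->
  exists F : bidual X, forall f, F f = l f.
Proof.
move=> ll lM.
have Fl (t : R) (f g h : D) : (forall x, h x = t * f x + g x) -> l h = t * l f + l g.
  by move=> hE; rewrite -ll; congr l; exact: dual_ext.
have Fb : exists M : R, forall (f : D) (K : R), 0 <= K -> dbound f K -> `|l f| <= M * K.
  exists `|M| => f K K0 fK; apply: (le_trans (lM f)).
  apply: (@le_trans _ _ (`|M| * `|f|)); first by rewrite ler_wpM2r// ler_norm.
  by rewrite ler_wpM2l// dual_norm_le.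
by exists (Bidual Fl Fb).
Qed.

Lemma dual_of (l : X -> R) (M : R) : lin_fun l -> (forall f, `|l f| <= M * `|f|) ->
  exists F : D, forall f, F f = l f.
Proof.
move=> ll lM; have lb : exists K, dbound l K by exists M.
by exists (Dual ll lb).
Qed.

Lemma bidualD_ex (F G : bidual X) (s t : R) :
  exists H : bidual X, forall f, H f = s * F f + t * G f.
Proof.
have [M M0 FM] := bidual_bound F; have [N N0 GN] := bidual_bound G.
apply: (@bidual_of _ (`|s| * M + `|t| * N)) => [a f g|f].
  by rewrite !bidual_lin; ring.
apply: (le_trans (ler_normD _ _)); rewrite !normrM mulrDl -!mulrA.
by rewrite lerD// ler_wpM2l.
Qed.

Lemma canon_ex (x : X) : exists F : bidual X, is_canon F x.
Proof.
apply: (@bidual_of (fun f => f x) `|x|) => [t f g//|f].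
by rewrite mulrC dual_bound.
Qed.

Lemma dual_pair_of (l : X * D -> R) (M : R) : lin_fun l ->
  (forall z, l z <= M * (`|z.1| + `|z.2|)) ->
  exists (a : D) (F : bidual X), forall z, l z = a z.1 + F z.2.
Proof.
move=> ll lM.
have lM' z : `|l z| <= M * (`|z.1| + `|z.2|).
  rewrite ler_norml lM andbT lerNl -(linN ll).
  by apply: (le_trans (lM _)); rewrite /= !normrN.
have [|x|a aE] := @dual_of (fun x => l (x, 0)) M.
- move=> t x y; rewrite -ll; congr l.
  by congr pair; rewrite /= scaler0 addr0.
- by have := lM' (x, 0); rewrite normr0 addr0.
have [|f|F FE] := @bidual_of (fun f => l (0, f)) M.
- move=> t x y; rewrite -ll; congr l.
  by congr pair; rewrite /= scaler0 addr0.
- by have := lM' (0, f); rewrite normr0 add0r.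
exists a, F => -[x f]; rewrite aE FE -(linD ll); congr l.
by congr pair; rewrite /= ?addr0 ?add0r.
Qed.

End DualNormed.

(** * Completeness along geometric sequences *)

Section GeometricCompleteness.
Variable R : realType.

(* Completeness along geometrically Cauchy sequences: all that is used, and it passes to
   products and holds for duals without building filters on them. *)
Definition geo_complete (E : normedModType R) := forall (u : nat -> E) (C : R),
  (forall n, `|u n.+1 - u n| <= C * 2^-1 ^+ n) ->
  exists l, forall n, `|l - u n| <= 2 * C * 2^-1 ^+ n.

Lemma geo_small (C e : R) : 0 < e -> exists N, forall n, (N <= n)%N -> C * 2^-1 ^+ n < e.
Proof.
move=> e0.
have [N HN] : exists N : nat, `|C| / e < N%:R.
  exists (Num.bound (`|C| / e)); apply: le_lt_trans (archi_boundP _); first exact: lexx.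
  by rewrite divr_ge0// ltW.
exists N => n Nn; have n2 : N%:R <= 2 ^+ n :> R.
  by rewrite -natrX ler_nat (leq_trans Nn)// ltnW// ltn_expl.
have p0 : 0 < 2 ^+ n :> R by rewrite exprn_gt0.
rewrite exprVn ltr_pdivrMr//.
apply: (le_lt_trans (ler_norm C)); rewrite -ltr_pdivrMl// mulrC.
exact: lt_le_trans HN n2.
Qed.

Lemma geo_dist (E : normedModType R) (u : nat -> E) (C : R) :
  (forall n, `|u n.+1 - u n| <= C * 2^-1 ^+ n) ->
  forall n k, `|u (n + k)%N - u n| <= 2 * C * 2^-1 ^+ n.
Proof.
move=> uC n k.
have C0 : 0 <= C by have := uC 0%N; rewrite expr0 mulr1; exact: le_trans.
(* The subtracted term is the remaining tail of the geometric series; it makes the induction on [k]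
   close. *)
suff : `|u (n + k)%N - u n| <= 2 * C * 2^-1 ^+ n - 2 * C * 2^-1 ^+ (n + k).
  by move/le_trans; apply; rewrite gerBl mulr_ge0// ?mulr_ge0// exprn_ge0.
elim: k => [|k IH]; first by rewrite addn0 !subrr normr0.
have := ler_normD (u (n + k.+1)%N - u (n + k)%N) (u (n + k)%N - u n).
rewrite addrA subrK => /le_trans; apply.
have := uC (n + k)%N; rewrite addnS exprS; move: IH.
move: (2^-1 ^+ (n + k)) (2^-1 ^+ n) => a b; lra.
Qed.

Lemma complete_geo (E : completeNormedModType R) : geo_complete E.
Proof.
move=> u C uC; have ud := geo_dist uC.
have : cauchy (u @ \oo).
  apply/cauchyP => e e0; have [N HN] := geo_small (2 * C) e0.
  exists (u N); exists N => //= n /subnKC <-; rewrite -ball_normE/= distrC.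
  exact: le_lt_trans (ud _ _) (HN _ (leqnn _)).
move/cauchy_cvg => /cvg_ex[l ul]; exists l => n.
apply/ler_addgt0Pr => e e0.
move: ul => /cvgrPdist_lt/(_ e e0)[N _ HN].
have := HN (n + N)%N (leq_addl _ _) => /= lN.
apply: (le_trans (ler_distD (u (n + N)%N) _ _)); rewrite addrC.
by apply: lerD; [exact: ud|exact: ltW].
Qed.

Lemma prod_geo (E F : normedModType R) : geo_complete E -> geo_complete F ->
  geo_complete (E * F)%type.
Proof.
move=> Ec Fc u C uC.
have [n|l lP] := Ec (fun n => (u n).1) C.
  by apply: le_trans (uC n); rewrite prod_normE le_max lexx.
have [n|m mP] := Fc (fun n => (u n).2) C.
  by apply: le_trans (uC n); rewrite prod_normE le_max lexx orbT.
by exists (l, m) => n; rewrite prod_normE ge_max lP mP.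
Qed.

(** The limit is taken pointwise; its rate at [x] is proportional to |x|, which is convergence in
    the dual norm. *)
Lemma dual_geo (X : normedModType R) : geo_complete (dual X).
Proof.
move=> u C uC; have ud := geo_dist uC.
have C0 : 0 <= C by have := uC 0%N; rewrite expr0 mulr1; exact: le_trans.
have ex x : exists l : R, forall n, `|l - u n x| <= 2 * (C * `|x|) * 2^-1 ^+ n.
  apply: (@complete_geo R^o) => n; rewrite -dualBE.
  by apply: (le_trans (dual_bound _ _)); rewrite mulrAC ler_wpM2r.
pose l x := sval (cid (ex x)).
have lP x n : `|l x - u n x| <= 2 * (C * `|x|) * 2^-1 ^+ n by rewrite /l; case: cid.
have ll : lin_fun l.
  move=> t x y; apply/eqP; rewrite -subr_eq0 -normr_le0; apply/ler_addgt0Pr => e e0.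
  pose B := 2 * (C * `|t *: x + y|) + `|t| * (2 * (C * `|x|)) + 2 * (C * `|y|).
  have [N /(_ N (leqnn N)) HN] := geo_small B e0.
  rewrite add0r; apply: le_trans (ltW HN).
  have -> : l (t *: x + y) - (t * l x + l y) =
    (l (t *: x + y) - u N (t *: x + y)) - (t * (l x - u N x) + (l y - u N y)).
    by rewrite dval_lin; ring.
  apply: (le_trans (ler_normB _ _)).
  apply: (le_trans (lerD (lP _ N) (ler_normD _ _))).
  rewrite normrM; have := lP y N; have := ler_wpM2l (normr_ge0 t) (lP x N).
  rewrite /B; move: (2^-1 ^+ N) => a.
  move: (`|l x - _|) (`|l y - _|) (`|t *: x + y|) (`|t|) => b1 b2 b3 b4; nra.
have [|f fE] := @dual_of R X l (`|u 0%N| + 2 * C) ll.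
  move=> x; have := lP x 0%N; rewrite expr0 mulr1 mulrDl => lx.
  have := dual_bound (u 0%N) x; have := ler_normD (l x - u 0%N x) (u 0%N x).
  rewrite subrK; move: lx; lra.
exists f => n; apply: dual_norm_le => [|x].
  by rewrite !mulr_ge0// exprn_ge0.
rewrite dualBE fE; apply: (le_trans (lP x n)).
by rewrite (mulrAC _ _ `|x|) !mulrA.
Qed.
End GeometricCompleteness.

(** * Calculus of finite convex functions *)

Section ConvexFunctions.
Variable R : realType.

Lemma cvx_funD (V : lmodType R) (f g : V -> R) :
  cvx_fun f -> cvx_fun g -> cvx_fun (fun x => f x + g x).
Proof.
by move=> fc gc x y t t01; have := fc x y t t01; have := gc x y t t01; lra.
Qed.

Lemma cvx_funZ (V : lmodType R) (c : R) (f : V -> R) :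
  0 <= c -> cvx_fun f -> cvx_fun (fun x => c * f x).
Proof.
by move=> c0 fc x y t t01; have := ler_wpM2l c0 (fc x y t t01); lra.
Qed.

Lemma cvx_fun_sum (V : lmodType R) (I : finType) (f : I -> V -> R) :
  (forall i, cvx_fun (f i)) -> cvx_fun (fun x => \sum_i f i x).
Proof.
move=> fc x y t t01; rewrite !mulr_sumr -big_split/=.
by apply: ler_sum => i _; exact: fc.
Qed.

Lemma cvx_fun_sqr (V : lmodType R) (f : V -> R) :
  (forall x, 0 <= f x) -> cvx_fun f -> cvx_fun (fun x => f x ^+ 2).
Proof.
move=> f0 fc x y t t01; have := fc x y t t01; have := f0 (t *: x + (1 - t) *: y).
have := f0 x; have := f0 y; case/andP: t01 => t0 t1.
move: (f (t *: x + _)) (f x) (f y)  => d a b b0 a0 d0 dab.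
have ta : 0 <= t * a by apply: mulr_ge0 => //; lra.
have tb : 0 <= (1 - t) * b by apply: mulr_ge0 => //; lra.
have : d ^+ 2 <= (t * a + (1 - t) * b) ^+ 2 by rewrite ler_sqr ?nnegrE ?addr_ge0.
have : 0 <= t * (1 - t) * (a - b) ^+ 2.
  by apply: mulr_ge0; [apply: mulr_ge0; lra|exact: sqr_ge0].
by rewrite !expr2; nra.
Qed.

Lemma cvx_fun_affine (V : lmodType R) (l : V -> R) (c : R) :
  lin_fun l -> cvx_fun (fun x => l x + c).
Proof. by move=> ll x y t _; rewrite (linD ll) !(linZ ll); lra. Qed.

Lemma cvx_fun_norm (V : lmodType R) (E : normedModType R) (f : V -> E) :
  (forall x y t, f (t *: x + (1 - t) *: y) = t *: f x + (1 - t) *: f y) ->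
  cvx_fun (fun x => `|f x|).
Proof.
move=> fa x y t /andP[t0 t1]; rewrite fa.
apply: (le_trans (ler_normD _ _)); rewrite !normrZ (gtr0_norm t0).
by rewrite (@gtr0_norm _ (1 - t)) ?subr_gt0.
Qed.

Lemma cvx_fun_max0 (V : lmodType R) (f : V -> R) :
  cvx_fun f -> cvx_fun (fun x => Num.max (f x) 0).
Proof.
move=> fc x y t t01; have := fc x y t t01; case/andP: t01 => t0 t1 fxy.
rewrite ge_max; apply/andP; split.
  apply: (le_trans fxy); apply: lerD; rewrite ler_pM2l ?subr_gt0//.
    by rewrite le_max lexx.
  by rewrite le_max lexx.
by rewrite addr_ge0// mulr_ge0 ?le_max ?lexx ?orbT//; lra.
Qed.

Lemma affine_subr (V W : lmodType R) (f : {linear V -> W}) (c : W) (x y : V) (t : R) :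
  f (t *: x + (1 - t) *: y) - c = t *: (f x - c) + (1 - t) *: (f y - c).
Proof.
rewrite linearD !linearZ !scalerBr addrACA -opprD -scalerDl.
by rewrite [X in X *: c]addrC subrK scale1r.
Qed.

End ConvexFunctions.

(** * Dual norm estimates, Goldstine's theorem, sandwich on X x X^* *)

Section DualPairs.
Variables (R : realType) (X : normedModType R).
Local Notation D := (dual X).

Lemma dual_norm_ball (f : D) (K m : R) : 0 < K ->
  (forall x, `|x| <= K -> f x <= m) -> `|f| <= m / K.
Proof.
move=> K0 fm; have m0 : 0 <= m.
  by have := fm 0; rewrite (lin0 (dval_lin f)) normr0; apply; exact: ltW.
apply: dual_norm_le => [|x]; first by rewrite divr_ge0// ltW.
have [->|x0] := eqVneq x 0.
  by rewrite (lin0 (dval_lin f)) !normr0 mulr0.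
have nx : 0 < `|x| by rewrite normr_gt0.
suff H y : `|y| = `|x| -> f y <= m / K * `|x|.
  by rewrite ler_norml H// andbT lerNl -(linN (dval_lin f)) H// normrN.
move=> yx; have := fm ((K / `|x|) *: y); rewrite normrZ yx ger0_norm; last first.
  by rewrite divr_ge0// ltW.
rewrite divfK ?gt_eqF// => /(_ (lexx _)); rewrite (linZ (dval_lin f)).
by rewrite mulrAC ler_pdivrMr// mulrC -ler_pdivlMr// mulrAC.
Qed.

Lemma dual_norm_attain (f : D) (d : R) : 0 < d -> exists2 x, `|x| <= 1 & `|f| - d < f x.
Proof.
move=> d0; apply: contrapT => H.
have : `|f| <= (`|f| - d) / 1.
  apply: (dual_norm_ball ltr01) => x x1; rewrite leNgt; apply/negP => fx.
  by apply: H; exists x.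
by rewrite divr1; lra.
Qed.

(** The infimum over [v] is -|f|^2/(2s), by conjugation of s/2 |.|^2. It is approached at -(|f|/s)
    x, where x in the unit ball almost attains |f|; the tolerance e s/(|f|+1) costs less than
    [e]. *)
Lemma dual_quadratic (f : D) (s e : R) : 0 < s -> 0 < e ->
  exists v, f v + s / 2 * `|v| ^+ 2 < - (`|f| ^+ 2 / (2 * s)) + e.
Proof.
move=> s0 e0; set b := `|f|; have b0 : 0 <= b by exact: normr_ge0.
have d0 : 0 < e * s / (b + 1) by rewrite divr_gt0 ?mulr_gt0//; lra.
have [x x1 fx] := dual_norm_attain f d0.
exists (- (b / s) *: x); rewrite (linZ (dval_lin f)) normrZ normrN ger0_norm; last first.
  by rewrite divr_ge0// ltW.
have bs0 : 0 <= b / s by rewrite divr_ge0// ltW.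
have H1 : (b / s * `|x|) ^+ 2 <= (b / s) ^+ 2.
  by apply: lerXn2r; rewrite ?nnegrE//; [exact: mulr_ge0|exact: ler_piMr].
have H2 : b / s * (b - e * s / (b + 1)) <= b / s * f x.
  by apply: ler_wpM2l => //; exact: ltW.
have H3 : s / 2 * (b / s * `|x|) ^+ 2 <= s / 2 * (b / s) ^+ 2.
  by apply: ler_wpM2l => //; lra.
have E1 : s / 2 * (b / s) ^+ 2 = b ^+ 2 / (2 * s).
  by field; rewrite gt_eqF.
have E2 : b / s * (b - e * s / (b + 1)) = 2 * (b ^+ 2 / (2 * s)) - e * (b / (b + 1)).
  by field; apply/andP; split; rewrite gt_eqF//; lra.
have H4 : e * (b / (b + 1)) < e.
  by rewrite gtr_pMr// ltr_pdivrMr; lra.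
by rewrite mulNr; lra.
Qed.

(** If the image of the ball stayed away from that of [F], a separating combination f of the [fs]
    would satisfy |f| <= (F f - e)/K, against F f <= K |f|. *)
Lemma goldstine (F : bidual X) (K e : R) (I : finType) (fs : I -> D) : 0 < K ->
  (forall f, `|F f| <= K * `|f|) -> 0 < e ->
  exists2 x, `|x| <= K & forall i, `|fs i x - F (fs i)| < e.
Proof.
move=> K0 FK e0; apply: contrapT => H.
pose A := [set v : I -> R | exists2 x, `|x| <= K & v = fun i => fs i x].
have [|v [x xK ->]|c cP] := @finite_separation R I A (fun i => F (fs i)) e e0.
- move=> _ _ t [x xK ->] [y yK ->] /andP[t0 t1]; exists (t *: x + (1 - t) *: y).
    apply: (le_trans (ler_normD _ _)); rewrite !normrZ (gtr0_norm t0).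
    by rewrite (@gtr0_norm _ (1 - t)) ?subr_gt0//; nra.
  apply/funext => i; rewrite (linD (dval_lin (fs i))).
  by rewrite !(linZ (dval_lin (fs i))).
- apply: contrapT => Hi; apply: H; exists x => // i.
  by rewrite ltNge; apply/negP => ei; apply: Hi; exists i.
pose f : D := \sum_i c i *: fs i.
have fx x : f x = \sum_i c i * fs i x.
  exact: (@lin_sum _ _ (fun f : D => f x) (fun _ _ _ => erefl)).
have Ff : F f = \sum_i c i * F (fs i) by exact: (lin_sum (bidual_lin F)).
have : `|f| <= (F f - e) / K.
  apply: (dual_norm_ball K0) => x xK; rewrite fx Ff; apply: cP; by exists x.
rewrite ler_pdivlMr// => fle; have := le_trans (ler_norm _) (FK f); lra.
Qed.

(** Boundedness of [q] on bounded sets bounds the functional of [sandwich] above on the unit box, so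
    it is continuous and comes from a pair in X^* x X^**. *)
Lemma sandwich_pair (A : set ((X * D) * R)) (q : X * D -> R) (m : R) :
  cvx_set A -> A !=set0 -> cvx_fun q ->
  (forall r, exists M, forall w, `|w.1| <= r -> `|w.2| <= r -> q w <= M) ->
  (forall z, A z -> m <= z.2 + q z.1) ->
  exists (a : D) (F : bidual X), forall z w, A z ->
    m + (a z.1.1 + F z.1.2) <= z.2 + q w + (a w.1 + F w.2).
Proof.
move=> Ac [z0 Az0] qc qb Am.
have [l [ll lP]] := sandwich Ac qc Am.
have [M HM] := qb (`|z0.1.1| + `|z0.1.2| + 1).
pose B := z0.2 + M - m.
have lB v : `|v.1| <= 1 -> `|v.2| <= 1 -> l v <= B.
  move=> v1 v2; have := lP z0 (z0.1 - v) Az0; rewrite subKr.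
  have := HM (z0.1 - v); rewrite /B /=.
  have := ler_normB z0.1.1 v.1; have := ler_normB z0.1.2 v.2.
  have := normr_ge0 z0.1.1; have := normr_ge0 z0.1.2.
  move=> h1 h2 h3 h4 h5; have := h5 ltac:(lra) ltac:(lra); lra.
have lN z : l z <= B * (`|z.1| + `|z.2|).
  set n := `|z.1| + `|z.2|; have [n0|n0] := eqVneq n 0.
    have [z1 z2] : `|z.1| <= 0 /\ `|z.2| <= 0.
      by move: n0 (normr_ge0 z.1) (normr_ge0 z.2); rewrite /n; lra.
    rewrite n0 mulr0 (_ : z = 0) ?(lin0 ll)//; case: z z1 z2 {n n0} => x f /=.
    by rewrite !normr_le0 => /eqP -> /eqP ->.
  have np : 0 < n by rewrite lt_def n0 /n addr_ge0.
  have := lB (n^-1 *: z); rewrite (linZ ll) /= !normrZ ger0_norm; last by rewrite invr_ge0 ltW.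
  rewrite ![n^-1 * _]mulrC !ler_pdivrMr// mul1r; apply.
    by rewrite /n lerDl.
  by rewrite /n lerDr.
have [a [F lE]] := dual_pair_of ll lN.
exists a, F => z w Az; have := lP z w Az; rewrite (linB ll) !lE; lra.
Qed.

End DualPairs.

(** * Quadratic and Lipschitz estimates for the coupling *)

Section CouplingEstimates.
Variables (R : realType) (X : normedModType R).
Local Notation D := (dual X).

Lemma dual_diff_diff (z w : X * D) :
  (z.2 - w.2) (z.1 - w.1) = z.2 z.1 - z.2 w.1 - w.2 z.1 + w.2 w.1.
Proof.
by rewrite dualBE (linB (dval_lin z.2)) (linB (dval_lin w.2)); ring.
Qed.

Lemma weighted_amgm (a b s : R) : 0 < s -> a * b <= s / 2 * b ^+ 2 + a ^+ 2 / (2 * s).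
Proof.
move=> s0; rewrite -subr_ge0.
have -> : s / 2 * b ^+ 2 + a ^+ 2 / (2 * s) - a * b = (2 * s)^-1 * (s * b - a) ^+ 2.
  by field; rewrite gt_eqF.
by rewrite mulr_ge0 ?sqr_ge0// invr_ge0; lra.
Qed.

Lemma pairing_amgm (f : D) x (s : R) : 0 < s ->
  0 <= f x + s / 2 * `|x| ^+ 2 + `|f| ^+ 2 / (2 * s).
Proof. by move=> s0; have := dual_ge f x; have := weighted_amgm `|f| `|x| s0; lra. Qed.

Lemma pairing_amgm1 (f : D) x : - (2^-1 * `|x| ^+ 2 + 2^-1 * `|f| ^+ 2) <= f x.
Proof. by have := pairing_amgm f x ltr01; lra. Qed.

(** Serves to divide a convexity inequality by the weight [t] and then let [t] tend to 0. *)
Lemma affine_near0 (A B e : R) : 0 < e ->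
  exists2 t, 0 < t < 1 & A - e < (1 - t) * A + t * B.
Proof.
move=> e0; have d0 : 0 < `|A - B| + e by rewrite ltr_wpDl.
have d2 : 0 < e / (2 * (`|A - B| + e)) by rewrite divr_gt0//; lra.
exists (e / (2 * (`|A - B| + e))).
  by rewrite d2 ltr_pdivrMr; have := normr_ge0 (A - B); lra.
have : e / (2 * (`|A - B| + e)) * (A - B) <= e / (2 * (`|A - B| + e)) * (`|A - B| + e).
  by rewrite ler_pM2l//; have := ler_norm (A - B); lra.
have -> : e / (2 * (`|A - B| + e)) * (`|A - B| + e) = e / 2.
  by field; rewrite gt_eqF.
lra.
Qed.

Lemma dual_dist (f g : D) x y (t : R) : `|x - y| <= t -> `|f - g| <= t ->
  `|f x - g y| <= t * (`|f| + `|x| + t).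
Proof.
move=> xy fg.
have -> : f x - g y = f (x - y) + (f - g) x - (f - g) (x - y).
  by rewrite !dualBE !(linB (dval_lin _)); ring.
have h1 := le_trans (dual_bound f (x - y)) (ler_wpM2l (normr_ge0 f) xy).
have h2 := le_trans (dual_bound (f - g) x) (ler_wpM2r (normr_ge0 x) fg).
have h3 := le_trans (dual_bound (f - g) (x - y)) (ler_pM (normr_ge0 _) (normr_ge0 _) fg xy).
have := ler_normB (f (x - y) + (f - g) x) ((f - g) (x - y)).
have := ler_normD (f (x - y)) ((f - g) x); lra.
Qed.

Lemma norm_sqr_dist (E : normedModType R) (x y : E) (t : R) : `|x - y| <= t ->
  `|y| ^+ 2 <= `|x| ^+ 2 + t * (2 * `|x| + t).
Proof.
move=> xy; have t0 := le_trans (normr_ge0 _) xy.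
have yx : `|y| <= `|x| + t.
  by have := ler_normB x (x - y); rewrite subKr; lra.
have : `|y| ^+ 2 <= (`|x| + t) ^+ 2 by apply: lerXn2r; rewrite ?nnegrE// addr_ge0.
by rewrite !expr2; lra.
Qed.

End CouplingEstimates.

(** * Strong representatives and the Brøndsted-Rockafellar property *)

Section ConvexRepresentative.
Variables (R : realType) (X : normedModType R).
Local Notation D := (dual X).
Implicit Types (h : X * D -> \bar R) (z w : X * D).

Lemma epi_cvx h : convex_fun h -> cvx_set [set p : (X * D) * R | (h p.1 <= p.2%:E)%E].
Proof.
move=> hc [z r] [w s] t /= hz hw t01.
have := hc z w (t *: (z, r) + (1 - t) *: (w, s)).1 t t01 erefl (fun _ => erefl).
move=> /le_trans; apply; case/andP: t01 => t0 t1.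
rewrite [leRHS](_ : _ = t%:E * r%:E + (1 - t)%:E * s%:E)%E//.
by apply: leeD; apply: lee_wpmul2l => //; rewrite lee_fin; lra.
Qed.

Lemma conj_fun_ge h (a : D) (F : bidual X) z r : (h z <= r%:E)%E ->
  ((a z.1 + F z.2 - r)%:E <= conj_fun h a F)%E.
Proof.
move=> hz; apply: (@le_trans _ _ ((a z.1 + F z.2)%:E - h z)%E).
  by rewrite EFinB leeB.
by apply: ereal_sup_ubound; exists z.
Qed.

Lemma conj_fun_le h (a : D) (F : bidual X) m : (forall z, h z != -oo%E) ->
  (forall z r, (h z <= r%:E)%E -> a z.1 + F z.2 - r <= m) ->
  (conj_fun h a F <= m%:E)%E.
Proof.
move=> hN hm; apply: ge_ereal_sup => _ [z _ <-].
case E : (h z) (hN z) (hm z) => [r| |] // _ Hz; last by rewrite leNye.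
by rewrite -EFinB lee_fin; apply: Hz; rewrite lexx.
Qed.

Definition contact h := [set z | h z = (coupling z)%:E].

Variable h : X * D -> \bar R.
Hypotheses (hc : convex_fun h) (hl : nlsc h)
  (hge : forall z, ((coupling z)%:E <= h z)%E)
  (hs : forall (a : D) (F : bidual X), ((F a)%:E <= conj_fun h a F)%E).

Let hN z : h z != -oo%E.
Proof. by have := hge z; case: (h z). Qed.

Lemma rep_ge z r : (h z <= r%:E)%E -> z.2 z.1 <= r.
Proof. by move=> hz; rewrite -lee_fin; apply: le_trans hz; exact: hge. Qed.

Lemma rep_cvx_ge z w r s (t : R) : (h z <= r%:E)%E -> (h w <= s%:E)%E -> 0 < t < 1 ->
  t * (t * z.2 z.1 + (1 - t) * z.2 w.1) + (1 - t) * (t * w.2 z.1 + (1 - t) * w.2 w.1)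
    <= t * r + (1 - t) * s.
Proof.
move=> hz hw t01.
have H := @rep_ge (t *: z + (1 - t) *: w) (t * r + (1 - t) * s)
  (@epi_cvx h hc (z, r) (w, s) t hz hw t01).
apply: le_trans H.
rewrite (_ : (t *: z + (1 - t) *: w).2 = t *: z.2 + (1 - t) *: w.2)//.
rewrite (_ : (t *: z + (1 - t) *: w).1 = t *: z.1 + (1 - t) *: w.1)//.
by rewrite dualDE !dualZE !(linD (dval_lin _)) !(linZ (dval_lin _)).
Qed.

(** The form in which the hypothesis on the conjugate is used: every real bound [m] for it is a
    bound for [F a]. *)
Lemma strong_rep_le (a : D) (F : bidual X) m :
  (forall z r, (h z <= r%:E)%E -> a z.1 + F z.2 - r <= m) -> F a <= m.
Proof. by move=> H; rewrite -lee_fin; apply: le_trans (hs a F) _; exact: conj_fun_le. Qed.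

Lemma strong_rep_proper : exists z r, (h z <= r%:E)%E.
Proof.
have [F _] := canon_ex (0 : X); apply: contrapT => H.
suff : F 0 <= F 0 - 1 by lra.
by apply: strong_rep_le => z r hz; case: H; exists z, r.
Qed.

(* The penalty is the conjugate of its own dual counterpart on pairs [(F, a)], so a
   positive lower bound would yield an affine minorant contradicting [h^* >= c]. *)
Lemma penalized_inf_le0 z0 (s e : R) : 0 < s -> 0 < e -> exists z r, (h z <= r%:E)%E /\
  r - z.2 z.1 + (z.2 - z0.2) (z.1 - z0.1)
    + s / 2 * `|z.1 - z0.1| ^+ 2 + `|z.2 - z0.2| ^+ 2 / (2 * s) < e.
Proof.
move=> s0 e0; apply: contrapT => H.
(* In r - c(w) + c(w - z0) the quadratic parts of the couplings cancel; what remains besides [r] is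
   affine, so the penalized function is convex. *)
pose q w : R := (- w.2 z0.1 - z0.2 w.1 + z0.2 z0.1)
  + (s / 2 * `|w.1 - z0.1| ^+ 2 + (2 * s)^-1 * `|w.2 - z0.2| ^+ 2).
have s20 : 0 <= s / 2 by lra.
have i2s0 : 0 <= (2 * s)^-1 by rewrite invr_ge0; lra.
have qc : cvx_fun q.
  apply: cvx_funD.
    apply: cvx_fun_affine => t x y /=.
    by rewrite (linD (dval_lin z0.2)) (linZ (dval_lin z0.2)); ring.
  apply: cvx_funD; apply: cvx_funZ => //; apply: cvx_fun_sqr => //.
    by apply: cvx_fun_norm => x y t; exact: (affine_subr fst).
  by apply: cvx_fun_norm => x y t; exact: (affine_subr snd).
have qb r : exists M, forall w, `|w.1| <= r -> `|w.2| <= r -> q w <= M.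
  exists (r * `|z0.1| + `|z0.2| * r + z0.2 z0.1
    + (s / 2 * (r + `|z0.1|) ^+ 2 + (2 * s)^-1 * (r + `|z0.2|) ^+ 2)) => w w1 w2.
  have r0 := le_trans (normr_ge0 _) w1.
  have := dual_ge w.2 z0.1; have := dual_ge z0.2 w.1.
  have := ler_wpM2r (normr_ge0 z0.1) w2; have := ler_wpM2l (normr_ge0 z0.2) w1.
  have N1 : s / 2 * `|w.1 - z0.1| ^+ 2 <= s / 2 * (r + `|z0.1|) ^+ 2.
    apply: ler_wpM2l => //; apply: lerXn2r; rewrite ?nnegrE ?addr_ge0//.
    by apply: (le_trans (ler_normB _ _)); rewrite lerD2r.
  have N2 : (2 * s)^-1 * `|w.2 - z0.2| ^+ 2 <= (2 * s)^-1 * (r + `|z0.2|) ^+ 2.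
    apply: ler_wpM2l => //; apply: lerXn2r; rewrite ?nnegrE ?addr_ge0//.
    by apply: (le_trans (ler_normB _ _)); rewrite lerD2r.
  rewrite /q; lra.
have [|z Az|a [F aF]] := sandwich_pair (m := e) (epi_cvx hc) _ qc qb.
- by have [z [r hz]] := strong_rep_proper; exists (z, r).
- rewrite leNgt; apply/negP => lt; apply: H; exists z.1, z.2; split => //.
  apply: le_lt_trans lt; rewrite dual_diff_diff /q (mulrC _ (2 * s)^-1); lra.
have Fa w : F a <= q w + (a w.1 + F w.2) - e.
  by apply: strong_rep_le => z r hz; have := aF (z, r) w hz => /=; lra.
have [v] := dual_quadratic (a - z0.2) s0 e0; rewrite dualBE => Hv.
(* The choice [w.2 = a] cancels the unknown [F a]; [v] almost minimizes what depends on the first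
   component. *)
pose w : X * D := (v + z0.1, a); have w1 : w.1 = v + z0.1 by [].
have w2 : w.2 = a by []; have := Fa w; rewrite /q w1 w2 addrK.
rewrite (linD (dval_lin a)) (linD (dval_lin z0.2)) (mulrC (2 * s)^-1); lra.
Qed.

(* Midpoint convexity between [z0] and an almost minimizer [z] of the penalized
   function bounds the length of the step. *)
Let BR_step z0 (e d : R) : 0 < e -> 0 < d -> (h z0 < (z0.2 z0.1 + e)%:E)%E ->
  exists z, [/\ (h z < (z.2 z.1 + d)%:E)%E,
    `|z.1 - z0.1| ^+ 2 <= 4 * (d + e) & `|z.2 - z0.2| ^+ 2 <= 4 * (d + e)].
Proof.
move=> e0 d0 hz0.
have [z [r [hz Hz]]] := penalized_inf_le0 z0 ltr01 d0.
have := pairing_amgm (z.2 - z0.2) (z.1 - z0.1) ltr01 => P.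
have h12 : 0 < (2^-1 : R) < 1 by lra.
have := rep_cvx_ge hz (ltW hz0) h12 => mid.
have := dual_diff_diff z z0 => E.
have := sqr_ge0 `|z.1 - z0.1|; have := sqr_ge0 `|z.2 - z0.2| => n2 n1.
exists z; split; [apply: le_lt_trans hz _; rewrite lte_fin| |]; lra.
Qed.

(** The coupling is locally Lipschitz and [h] lower semicontinuous, so norm limits of points with
    vanishing gap h - c are contact points. *)
Lemma nlsc_le_coupling z :
  (forall e, 0 < e -> exists w, nclose z w e /\ (h w < (w.2 w.1 + e)%:E)%E) ->
  contact h z.
Proof.
move=> Hz; apply/eqP; rewrite eq_le hge andbT leNgt; apply/negP => lt.
have [r /andP[r1 r2]] : exists r : R, ((coupling z)%:E < r%:E < h z)%E.
  case: (h z) lt => [s| |]//; last first.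
    by move=> _; exists (coupling z + 1); rewrite lte_fin ltrDl ltr01 ltry.
  by rewrite lte_fin => lt; exists ((coupling z + s) / 2); rewrite !lte_fin; lra.
have [e [e0 He]] := hl r2; rewrite lte_fin /coupling in r1.
pose t := Num.min (Num.min e 1) ((r - z.2 z.1) / (`|z.2| + `|z.1| + 3)).
have B0 : 0 < `|z.2| + `|z.1| + 3.
  by have := normr_ge0 z.1; have := normr_ge0 z.2; lra.
have t0 : 0 < t by rewrite !lt_min e0 ltr01 divr_gt0//; lra.
have [w [/ncloseP[w1 w2] hw]] := Hz t t0.
have [te t1 tr] : [/\ t <= e, t <= 1 & t * (`|z.2| + `|z.1| + 3) <= r - z.2 z.1].
  by rewrite -ler_pdivlMr// /t !ge_min !lexx ?orbT.
have zw : nclose z w e.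
  by apply/ncloseP; split; [exact: lt_le_trans w1 te|exact: lt_le_trans w2 te].
have := lt_trans (He w zw) hw; rewrite lte_fin.
have := dual_dist (ltW w1) (ltW w2); rewrite ler_norml => /andP[+ _].
by nra.
Qed.

Hypothesis Xc : geo_complete X.



(* Brøndsted--Rockafellar property, by iterating the step with geometrically decreasing gaps. *)
Lemma gap_approx z0 (e : R) : 0 < e -> (h z0 < (z0.2 z0.1 + e ^+ 2)%:E)%E ->
  exists2 z, contact h z & `|z.1 - z0.1| <= 6 * e /\ `|z.2 - z0.2| <= 6 * e.
Proof.
move=> e0 hz0.
pose en (n : nat) : R := e * 2^-1 ^+ n.
have en0 n : 0 < en n by rewrite mulr_gt0// exprn_gt0.
have enS n : en n.+1 = en n / 2 by rewrite /en exprS; lra.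
have step n z : exists z', (h z < (z.2 z.1 + en n ^+ 2)%:E)%E ->
    [/\ (h z' < (z'.2 z'.1 + en n.+1 ^+ 2)%:E)%E,
        `|z'.1 - z.1| <= 3 * en n & `|z'.2 - z.2| <= 3 * en n].
  have [hz|] := pselect (h z < (z.2 z.1 + en n ^+ 2)%:E)%E; last by exists z.
  have [z' [h1 h2 h3]] := BR_step (exprn_gt0 2 (en0 n)) (exprn_gt0 2 (en0 n.+1)) hz.
  (* The gaps [en n ^+ 2] and [en n.+1 ^+ 2] give a factor 4 (1 + 1/4) = 5 <= 9, hence steps of at
     most [3 * en n], which sum to [6 * e]. *)
  have le_en (x : R) : 0 <= x -> x ^+ 2 <= 4 * (en n.+1 ^+ 2 + en n ^+ 2) -> x <= 3 * en n.
    have := en0 n; rewrite enS !expr2 => en0' x0 xle.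
    rewrite leNgt; apply/negP => lt; nra.
  by exists z' => _; split => //; exact: le_en.
have [f fP] := choice (fun nz : nat * (X * D) => step nz.1 nz.2).
pose u := fix u n := if n is n'.+1 then f (n', u n') else z0.
have uP n : (h (u n) < ((u n).2 (u n).1 + en n ^+ 2)%:E)%E.
  elim: n => [|n IH]; first by rewrite /en expr0 mulr1.
  by have [] := fP (n, u n) IH.
have u1 n : `|(u n.+1).1 - (u n).1| <= 3 * e * 2^-1 ^+ n.
  by have [_ + _] := fP (n, u n) (uP n); rewrite mulrA.
have u2 n : `|(u n.+1).2 - (u n).2| <= 3 * e * 2^-1 ^+ n.
  by have [_ _] := fP (n, u n) (uP n); rewrite mulrA.
have [x xP] := Xc u1; have [a aP] := @dual_geo R X _ _ u2.
exists (x, a); last first.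
  by split; [have := xP 0%N|have := aP 0%N]; rewrite /= expr0 mulr1 mulrA; lra.
apply: nlsc_le_coupling => t t0.
have [N1 /(_ _ (leq_maxl N1 _)) HN1] := geo_small (2 * (3 * e)) t0.
have [N2 HN2] := geo_small (e ^+ 2) t0.
pose n := maxn N1 N2; have {}HN1 := HN1 N2.
have {}HN2 := HN2 n (leq_maxr _ _).
exists (u n); split.
  by apply/ncloseP; split; [exact: le_lt_trans (xP n) _|exact: le_lt_trans (aP n) _].
apply: lt_trans (uP n) _; rewrite lte_fin ltrD2l; apply: le_lt_trans HN2.
rewrite /en exprMn ler_wpM2l ?sqr_ge0// expr2 ler_piMl ?exprn_ge0//.
by apply: exprn_ile1 => //; lra.
Qed.

(** The swapped pair (z0.2, z0.1) is a subgradient of [h] at [z0]: write c <= h at t z + (1-t) z0,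
    divide by [t] and let [t] tend to 0. *)
Lemma touching_subgradient z0 z r : contact h z0 -> (h z <= r%:E)%E ->
  z0.2 z.1 + z.2 z0.1 - z0.2 z0.1 <= r.
Proof.
rewrite /contact /= => Mz0 hz; apply/ler_addgt0Pr => e e0.
have [t t01] := affine_near0 (z0.2 z.1 + z.2 z0.1 - z0.2 z0.1) (z.2 z.1) e0.
have hz0 : (h z0 <= (z0.2 z0.1)%:E)%E by rewrite Mz0.
have := rep_cvx_ge hz hz0 t01.
case/andP: t01 => t0 t1; set A := z0.2 z0.1; set B := z0.2 z.1; set C := z.2 z0.1.
set G := z.2 z.1 => H1 H2.
suff : (1 - t) * (B + C - A) + t * G <= r by lra.
by rewrite -(ler_pM2l t0); lra.
Qed.

End ConvexRepresentative.

(** * Maximal monotonicity and negative infimum on the contact set *)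

Section ContactTypeD.
Variables (R : realType) (X : normedModType R) (h : X * dual X -> \bar R).
Local Notation D := (dual X).
Hypotheses (hc : convex_fun h) (hl : nlsc h)
  (hge : forall z, ((coupling z)%:E <= h z)%E)
  (hs : forall (a : D) (F : bidual X), ((F a)%:E <= conj_fun h a F)%E)
  (Xc : geo_complete X).

Let contact_le z : contact h z -> (h z <= (z.2 z.1)%:E)%E.
Proof. by move=> ->. Qed.

Lemma contact_nonempty : contact h !=set0.
Proof.
have [z [r [hz Hz]]] := penalized_inf_le0 hc hge hs (0, 0) ltr01 ltr01.
have := pairing_amgm (z.2 - 0) (z.1 - 0) ltr01 => P.
have [|w Mw _] := gap_approx hc hl hge hs Xc (z0 := z) ltr01; last by exists w.
by apply: le_lt_trans hz _; rewrite lte_fin expr1n; move: Hz P => /=; lra.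
Qed.

Lemma contact_monotone : Defs.monotone (contact h).
Proof.
move=> z w Mz Mw; have := touching_subgradient hc hge Mz (contact_le Mw); lra.
Qed.

(** A contact point supplies an affine minorant of [h], against which the quadratic penalty is
    coercive. The radius [B] is thus available before any precision is chosen. *)
Let penalized_bounded z0 (s : R) : 0 < s -> exists B, 0 <= B /\ forall z r, (h z <= r%:E)%E ->
  r - z.2 z.1 + (z.2 - z0.2) (z.1 - z0.1)
    + s / 2 * `|z.1 - z0.1| ^+ 2 + `|z.2 - z0.2| ^+ 2 / (2 * s) < 1 ->
  `|z.1 - z0.1| <= B /\ `|z.2 - z0.2| <= B.
Proof.
move=> s0; have [w Mw] := contact_nonempty.
pose P := `|w.1 - z0.1|; pose Q := `|w.2 - z0.2|.
pose C := 1 + (w.2 w.1 - w.2 z0.1 - z0.2 w.1 + z0.2 z0.1) + s * P ^+ 2 + Q ^+ 2 / s.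
exists (1 + `|4 * C / s| + `|4 * C * s|); split; first by rewrite !addr_ge0.
move=> z r hz; have := touching_subgradient hc hge Mw hz.
rewrite dual_diff_diff; set u := z.1 - z0.1; set v := z.2 - z0.2 => T H.
have Ev : v (w.1 - z0.1) = z.2 w.1 - z.2 z0.1 - z0.2 w.1 + z0.2 z0.1.
  by rewrite /v dualBE !(linB (dval_lin _)); ring.
have Eu : (w.2 - z0.2) u = w.2 z.1 - w.2 z0.1 - z0.2 z.1 + z0.2 z0.1.
  by rewrite /u dualBE !(linB (dval_lin _)); ring.
have hv := dual_ge v (w.1 - z0.1); have hu := dual_ge (w.2 - z0.2) u.
have s2 : 0 < 2 * s by lra.
(* The weights 2s and s/2 absorb the linear terms in [u] and [v] while leaving half of each
   quadratic term. *)
have A1 := weighted_amgm `|v| P s2.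
have A2 := weighted_amgm Q `|u| (divr_gt0 s0 (ltr0n _ 2)).
have E1 : s / 2 / 2 * `|u| ^+ 2 + Q ^+ 2 / (2 * (s / 2)) = s / 4 * `|u| ^+ 2 + Q ^+ 2 / s.
  by field; rewrite gt_eqF.
have E2 : 2 * s / 2 * P ^+ 2 + `|v| ^+ 2 / (2 * (2 * s)) = s * P ^+ 2 + `|v| ^+ 2 / s / 4.
  by field; rewrite gt_eqF.
have E3 : `|v| ^+ 2 / (2 * s) = `|v| ^+ 2 / s / 2 by field; rewrite gt_eqF.
rewrite E1 in A2; rewrite E2 in A1; rewrite E3 in H.
have key : s / 4 * `|u| ^+ 2 + `|v| ^+ 2 / s / 4 <= C.
  by rewrite /C -/P in hv *; rewrite -/Q in hu; lra.
have v0 : 0 <= `|v| ^+ 2 / s by rewrite divr_ge0 ?sqr_ge0// ltW.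
have u0 : 0 <= s * `|u| ^+ 2 by rewrite mulr_ge0 ?sqr_ge0// ltW.
have le1 (x : R) : x <= 1 + x ^+ 2.
  by have := sqr_ge0 (x - 1); have := sqr_ge0 x; rewrite !expr2; lra.
split.
  have : `|u| ^+ 2 <= 4 * C / s by rewrite ler_pdivlMr//; lra.
  have := le1 `|u|; have := ler_norm (4 * C / s); have := normr_ge0 (4 * C * s); lra.
have : `|v| ^+ 2 <= 4 * C * s by rewrite -ler_pdivrMr//; lra.
have := le1 `|v|; have := ler_norm (4 * C * s); have := normr_ge0 (4 * C / s); lra.
Qed.

(** The almost minimizers of [penalized_inf_le0] have small gap but need not be contact points;
    [gap_approx] moves them there, and the uniform radius [B] controls the change of the penalty. *)
Lemma contact_penalized z0 (s e : R) : 0 < s -> 0 < e -> exists2 z, contact h z &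
  (z.2 - z0.2) (z.1 - z0.1)
    + s / 2 * `|z.1 - z0.1| ^+ 2 + `|z.2 - z0.2| ^+ 2 / (2 * s) < e.
Proof.
move=> s0 e0; have [B [B0 HB]] := penalized_bounded z0 s0.
have i2s0 : 0 < (2 * s)^-1 by rewrite invr_gt0; lra.
pose L := (2 * B + 1) * (1 + s / 2 + (2 * s)^-1).
have L0 : 0 < L by apply: mulr_gt0; lra.
pose t := Num.min 1 (e / (2 * L + 4)).
have t0 : 0 < t by rewrite lt_min ltr01 divr_gt0//; lra.
have [t1 te] : t <= 1 /\ t * (2 * L + 4) <= e.
  by rewrite -ler_pdivlMr ?ge_min ?lexx ?orbT//; lra.
have t60 : 0 < t / 6 by lra.
have t61 : (t / 6) ^+ 2 <= t by rewrite expr2; nra.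
(* A gap below (t/6)^2 lets [gap_approx] move each component by at most [t]. *)
have [z [r [hz Hz]]] := penalized_inf_le0 hc hge hs z0 s0 (exprn_gt0 2 t60).
have [|zB1 zB2] := HB z r hz; first by apply: lt_le_trans Hz _; lra.
have rz := rep_ge hge hz.
have Pz := pairing_amgm (z.2 - z0.2) (z.1 - z0.1) s0.
have [|w Mw [zw1 zw2]] := gap_approx hc hl hge hs Xc (z0 := z) t60.
  by apply: le_lt_trans hz _; rewrite lte_fin; lra.
exists w => //.
have shift (V : zmodType) (x y c : V) : (x - c) - (y - c) = x - y.
  by rewrite opprB addrA subrK.
have d1 : `|(z.1 - z0.1) - (w.1 - z0.1)| <= t by rewrite shift distrC; lra.
have d2 : `|(z.2 - z0.2) - (w.2 - z0.2)| <= t by rewrite shift distrC; lra.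
have := dual_dist d1 d2; rewrite ler_norml => /andP[+ _].
have := norm_sqr_dist d1; have := norm_sqr_dist d2.
move: Hz Pz zB1 zB2; rewrite ![_ / (2 * s)]mulrC.
set u := `|z.1 - z0.1|; set v := `|z.2 - z0.2|.
set u' := `|w.1 - z0.1|; set v' := `|w.2 - z0.2|.
set d := dval (z.2 - z0.2) _; set d' := dval (w.2 - z0.2) _ => Hz Pz uB vB n2 n1 n3.
have tu : t * (2 * u + t) <= t * (2 * B + 1) by rewrite ler_pM2l//; lra.
have tv : t * (2 * v + t) <= t * (2 * B + 1) by rewrite ler_pM2l//; lra.
have td : t * (v + u + t) <= t * (2 * B + 1) by rewrite ler_pM2l//; lra.
have s20 : 0 < s / 2 by lra.
have m1 : s / 2 * u' ^+ 2 <= s / 2 * (u ^+ 2 + t * (2 * B + 1)).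
  by rewrite ler_pM2l//; lra.
have m2 : (2 * s)^-1 * v' ^+ 2 <= (2 * s)^-1 * (v ^+ 2 + t * (2 * B + 1)).
  by rewrite ler_pM2l//; lra.
have EL : t * L = t * (2 * B + 1) + s / 2 * (t * (2 * B + 1)) + (2 * s)^-1 * (t * (2 * B + 1)).
  by rewrite /L; ring.
lra.
Qed.

(** For [z0] monotonically related to the contact set, the pairing in [contact_penalized] is
    nonnegative; the norms alone are then small, and contact points converge to [z0]. *)
Lemma contact_maximal : maximal_monotone (contact h).
Proof.
split; first exact: contact_monotone.
move=> z0 Hz0; apply: nlsc_le_coupling => // e e0.
have e20 : 0 < e ^+ 2 / 2 by rewrite divr_gt0 ?exprn_gt0.
have [z Mz Hz] := contact_penalized z0 ltr01 e20.
exists z; split; last first.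
  by apply: le_lt_trans (contact_le Mz) _; rewrite lte_fin ltrDl.
have := Hz0 z Mz; rewrite dual_diff_diff in Hz => d0.
have := sqr_ge0 `|z.1 - z0.1|; have := sqr_ge0 `|z.2 - z0.2| => n2 n1.
have le_e (x : R) : 0 <= x -> x ^+ 2 < e ^+ 2 -> x < e.
  by move=> x0; rewrite ltr_pXn2r// nnegrE ltW.
by apply/ncloseP; split; rewrite distrC; apply: le_e => //; lra.
Qed.

(* The penalty weight is chosen to absorb the term [F (a - z.2)], unbounded in norm. *)
Lemma contact_negative_infimum (a : D) (F : bidual X) (e : R) : 0 < e ->
  exists2 z, contact h z & F a - F z.2 - a z.1 + z.2 z.1 < e.
Proof.
move=> e0; have [K K0 FK] := bidual_bound F.
have s0 : 0 < e / K ^+ 2 by rewrite divr_gt0// exprn_gt0.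
have e2 : 0 < e / 2 by lra.
have [z Mz Hz] := contact_penalized (0, a) s0 e2.
exists z => //; move: Hz; rewrite dual_diff_diff /= (lin0 (dval_lin _)) (lin0 (dval_lin a)).
have n0 : 0 <= e / K ^+ 2 / 2 * `|z.1 - 0| ^+ 2.
  by rewrite mulr_ge0 ?sqr_ge0// divr_ge0// ltW.
have := FK (z.2 - a); rewrite (linB (bidual_lin F)) ler_norml => /andP[Fz _].
have := weighted_amgm `|z.2 - a| K s0.
rewrite (_ : e / K ^+ 2 / 2 * K ^+ 2 = e / 2); last by field; rewrite gt_eqF.
lra.
Qed.

(** Bidual counterpart of [touching_subgradient]: the negative infimum property at t (a, F) + (1-t)
    (a0, F0), where the [gossez] inequality absorbs the part in (a0, F0) before division by [t]. *)
Lemma gossez_contact_subgradient (a0 : D) (F0 : bidual X) (a : D) (F : bidual X) (e : R) :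
  gossez (contact h) (F0, a0) -> 0 < e ->
  exists2 z, contact h z & F0 a + F a0 - F0 a0 - e <= a z.1 + F z.2 - z.2 z.1.
Proof.
move=> G0 e0; have e2 : 0 < e / 2 by lra.
have [t /andP[t0 t1]] := affine_near0 (F0 a + F a0 - F0 a0) (F a) e2.
have [Ft FtE] := bidualD_ex F F0 t (1 - t).
have te : 0 < t * (e / 2) by rewrite mulr_gt0.
have [z Mz] := contact_negative_infimum (t *: a + (1 - t) *: a0) Ft te.
rewrite FtE (linD (bidual_lin _)) (linD (bidual_lin F0)) !(linZ (bidual_lin _)).
rewrite dualDE !dualZE FtE => Hz H; exists z => //.
have /= := G0 z Mz => G1.
have G2 : (1 - t) * (a0 z.1 + F0 z.2 - z.2 z.1) <= (1 - t) * F0 a0.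
  by apply: ler_wpM2l; lra.
by rewrite -(ler_pM2l t0); nra.
Qed.

End ContactTypeD.

(** * Type (D) of the contact set *)

Section ContactGossez.
Variables (R : realType) (X : normedModType R) (h : X * dual X -> \bar R).
Local Notation D := (dual X).
Hypotheses (hc : convex_fun h) (hl : nlsc h)
  (hge : forall z, ((coupling z)%:E <= h z)%E)
  (hs : forall (a : D) (F : bidual X), ((F a)%:E <= conj_fun h a F)%E)
  (Xc : geo_complete X).

Let hull : set ((X * D) * R) := [set p | forall A : set ((X * D) * R), cvx_set A ->
  (forall z, contact h z -> A (z, z.2 z.1)) -> A p].

Let hull_cvx : cvx_set hull.
Proof. by move=> x y t hx hy t01 A Ac AM; apply: (Ac) => //; [apply: hx|apply: hy]. Qed.

Let hull_contact z : contact h z -> hull (z, z.2 z.1).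
Proof. by move=> Mz A _; apply. Qed.

Let hull_epi z r : hull (z, r) -> (h z <= r%:E)%E.
Proof. by move=> /(_ _ (epi_cvx hc)); apply => w Mw; rewrite /= Mw lexx. Qed.

(** Here [x] stands for |z.1|, [a] for |z.2 - a0| and [T] for the penalty of [hull_approx]. Once T
    >= e^2, the factor 1 + 2A pays for the level [n] and for the quadratic lower bound of the
    coupling. *)
Let penalty_dominates (n K A : R) (x a0 a T e : R) : 0 <= x -> 0 <= K -> 0 < e ->
  Num.max (x - K) 0 ^+ 2 + a ^+ 2 <= T -> e ^+ 2 <= T ->
  n <= e ^+ 2 * A -> K ^+ 2 + a0 ^+ 2 <= e ^+ 2 * A -> 0 <= A ->
  n <= - (2^-1 * x ^+ 2 + 2^-1 * (a0 + a) ^+ 2) + (1 + 2 * A) * T.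
Proof.
move=> x0 K0 e0 T1 T2 nA KA A0.
set m := Num.max (x - K) 0 in T1 *.
have xm : x <= K + m by rewrite -lerBlDl le_max lexx.
have x2 : x ^+ 2 <= (K + m) ^+ 2.
  by apply: lerXn2r; rewrite ?nnegrE//; apply: le_trans xm.
have := sqr_ge0 (K - m); have := sqr_ge0 (a0 - a).
have : e ^+ 2 * A <= T * A by apply: ler_wpM2r.
rewrite !expr2 in x2 T1 T2 nA KA *; lra.
Qed.

(** Otherwise the penalty [C * T] would lift the hull above [F0 a0 + e], and the affine functional
    from the sandwich would contradict [gossez_contact_subgradient] at a Goldstine approximation of
    [F0], where [T] almost vanishes. *)
Let hull_approx (a0 : D) (F0 : bidual X) (K e : R) (I : finType) (fs : I -> D) :
  gossez (contact h) (F0, a0) -> 0 < K -> (forall f, `|F0 f| <= K * `|f|) -> 0 < e ->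
  exists z r, [/\ hull (z, r), `|z.1| <= K + e, forall i, `|fs i z.1 - F0 (fs i)| < e,
    `|z.2 - a0| < e & r < F0 a0 + e].
Proof.
move=> G0 K0 FK e0; apply: contrapT => H.
pose T (z : X * D) : R := \sum_i `|fs i z.1 - F0 (fs i)| ^+ 2
  + (`|z.2 - a0| ^+ 2 + Num.max (`|z.1| - K) 0 ^+ 2).
have S0 (z : X * D) : 0 <= \sum_i `|fs i z.1 - F0 (fs i)| ^+ 2.
  by apply: sumr_ge0 => i _; exact: sqr_ge0.
pose A := (`|F0 a0 + e| + K ^+ 2 + `|a0| ^+ 2) / e ^+ 2.
have e2 : 0 < e ^+ 2 by rewrite exprn_gt0.
have A0 : 0 <= A by rewrite divr_ge0 ?addr_ge0 ?sqr_ge0.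
have EA : e ^+ 2 * A = `|F0 a0 + e| + K ^+ 2 + `|a0| ^+ 2.
  by rewrite /A mulrC divfK// gt_eqF.
pose C := 1 + 2 * A; have C0 : 0 < C by rewrite /C; lra.
have Tc : cvx_fun T.
  apply: cvx_funD; [apply: cvx_fun_sum => i|apply: cvx_funD]; apply: cvx_fun_sqr => //=.
  - apply: (@cvx_fun_norm _ _ R^o) => x y t.
    rewrite (_ : (t *: x + (1 - t) *: y).1 = t *: x.1 + (1 - t) *: y.1)//.
    rewrite (linD (dval_lin _)) !(linZ (dval_lin _)).
    transitivity (t * (fs i x.1 - F0 (fs i)) + (1 - t) * (fs i y.1 - F0 (fs i))); last by [].
    by ring.
  - by apply: cvx_fun_norm => x y t; exact: (affine_subr snd).
  - by move=> x; rewrite le_max lexx orbT.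
  - apply: cvx_fun_max0; apply: cvx_funD; last by move=> x y t _; lra.
    by apply: cvx_fun_norm.
have lt_of_sqr (x : R) : x ^+ 2 < e ^+ 2 -> x < e.
  move=> xe; rewrite ltNge; apply/negP => ex; move: xe; apply/negP; rewrite -leNgt.
  by apply: lerXn2r => //; rewrite nnegrE; lra.
have [||||z Hz|a [F aF]] := @sandwich_pair R X hull (fun w => C * T w) (F0 a0 + e).
- exact: hull_cvx.
- by have [z Mz] := contact_nonempty hc hl hge hs Xc; exists (z, z.2 z.1); exact: hull_contact.
- by apply: cvx_funZ => //; lra.
- move=> r; exists (C * (\sum_i (`|fs i| * `|r| + `|F0 (fs i)|) ^+ 2
    + ((`|r| + `|a0|) ^+ 2 + `|r| ^+ 2))) => w w1 w2.
  have r0 := le_trans (normr_ge0 _) w1; rewrite (ger0_norm r0).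
  apply: ler_wpM2l; first lra.
  apply: lerD; [apply: ler_sum => i _|apply: lerD]; apply: lerXn2r; rewrite ?nnegrE ?addr_ge0 ?mulr_ge0//.
  - apply: (le_trans (ler_normB _ _)); rewrite lerD2r.
    by apply: (le_trans (dual_bound _ _)); rewrite ler_wpM2l.
  - by apply: (le_trans (ler_normB _ _)); rewrite lerD2r.
  - by rewrite le_max lexx orbT.
  - by rewrite ge_max r0 andbT; lra.
- case: z Hz => z r Hz /=.
  (* A small penalty means that all conditions but the height hold, so [H] forces the height; a
     large one beats the lower bound r >= c(z). *)
  have [Tlt|Tge] := ltP (T z) (e ^+ 2).
    have m0 := sqr_ge0 (Num.max (`|z.1| - K) 0); have n0 := sqr_ge0 `|z.2 - a0|.
    have CT : 0 <= C * T z by apply: mulr_ge0; [lra|rewrite /T; have := S0 z; lra].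
    suff : F0 a0 + e <= r by lra.
    rewrite leNgt; apply/negP => rlt; apply: H; exists z, r; split => //.
    + have /lt_of_sqr : Num.max (`|z.1| - K) 0 ^+ 2 < e ^+ 2.
        by move: Tlt; rewrite /T; have := S0 z; lra.
      by rewrite gt_max => /andP[]; lra.
    + move=> i; apply: lt_of_sqr; move: Tlt; rewrite /T (bigD1 i)//=.
      have : 0 <= \sum_(j | j != i) `|fs j z.1 - F0 (fs j)| ^+ 2.
        by apply: sumr_ge0 => j _; exact: sqr_ge0.
      lra.
    + by apply: lt_of_sqr; move: Tlt; rewrite /T; have := S0 z; lra.
  have cr := rep_ge hge (hull_epi Hz).
  have c1 := pairing_amgm1 z.2 z.1.
  have z2 : `|z.2| ^+ 2 <= (`|a0| + `|z.2 - a0|) ^+ 2.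
    apply: lerXn2r; rewrite ?nnegrE ?addr_ge0// addrC.
    by have := ler_normD (z.2 - a0) a0; rewrite subrK.
  have := @penalty_dominates (F0 a0 + e) K A `|z.1| `|a0| `|z.2 - a0| (T z) e
    (normr_ge0 _) (ltW K0) e0.
  rewrite EA -/C; have := ler_norm (F0 a0 + e); have := sqr_ge0 K; have := sqr_ge0 `|a0|.
  move=> a00 K00 Fle /(_ _ Tge _ _ A0) PD.
  have {PD} := PD _ _ _; move/(_ ltac:(rewrite /T; have := S0 z; lra)).
  move/(_ ltac:(lra)) => /(_ ltac:(have := normr_ge0 (F0 a0 + e); lra)); lra.
(* The functional [a] found by the sandwich joins the tested ones, so that Goldstine also controls
   [a x]. *)
pose gs (o : option I) := if o is Some i then fs i else a.
pose N := C * #|I|%:R + 1.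
have CN : 0 <= C * #|I|%:R by rewrite mulr_ge0 ?ler0n// ltW.
pose t := Num.min 1 (e / (2 * N)).
have t0 : 0 < t by rewrite lt_min ltr01 divr_gt0// /N; lra.
have [t1 te] : t <= 1 /\ t * (2 * N) <= e.
  by rewrite -ler_pdivlMr ?ge_min ?lexx ?orbT//; rewrite /N; lra.
have [x xK xg] := goldstine gs K0 FK t0.
have Tx : T (x, a0) <= t * #|I|%:R.
  rewrite /T /= subrr normr0 expr0n/= add0r (_ : Num.max _ _ = 0); last first.
    by apply/max_idPr; lra.
  rewrite expr0n /= addr0 mulr_natr -sumr_const; apply: ler_sum => i _.
  have := xg (Some i) => /= lt; have := normr_ge0 (fs i x - F0 (fs i)); rewrite expr2; nra.
have CTx : C * T (x, a0) <= C * (t * #|I|%:R) by apply: ler_wpM2l => //; lra.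
have ax : a x <= F0 a + t.
  by have := xg None => /=; have := ler_norm (a x - F0 a); lra.
have e4 : 0 < e / 4 by lra.
have [z Mz Hz] := gossez_contact_subgradient hc hl hge hs Xc a F G0 e4.
have := aF (z, z.2 z.1) (x, a0) (hull_contact Mz) => /=.
have : t * (2 * N) = 2 * (C * (t * #|I|%:R) + t) by rewrite /N; ring.
lra.
Qed.

(** Testing [a0] as well makes the coupling of the hull point close to [F0 a0], so its gap is below
    d (3 + K) = v^2 and [gap_approx] moves it into [contact h] by at most 6 v. The bound K + 1 + 6
    does not depend on the tested functionals. *)
Lemma gossez_contact_approx (a0 : D) (F0 : bidual X) : gossez (contact h) (F0, a0) ->
  exists B, forall (I : finType) (fs : I -> D) (e : R), 0 < e ->
  exists z, [/\ contact h z, `|z.1| <= B, forall i, `|fs i z.1 - F0 (fs i)| < e &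
    `|z.2 - a0| < e].
Proof.
move=> G0; have [K K0 FK] := bidual_bound F0; exists (K + 7) => I fs e e0.
pose L := \sum_i `|fs i| + 1.
have L1 : 1 <= L by rewrite lerDr sumr_ge0.
have fL i : `|fs i| <= L.
  rewrite /L (bigD1 i)//= -addrA lerDl addr_ge0// sumr_ge0// => *; exact: normr_ge0.
pose v := Num.min 1 (e / (7 * L)).
have v0 : 0 < v by rewrite lt_min ltr01 divr_gt0//; lra.
have [v1 ve] : v <= 1 /\ v * (7 * L) <= e.
  by rewrite -ler_pdivlMr ?ge_min ?lexx ?orbT//; lra.
pose d := v ^+ 2 / (3 + K).
have d0 : 0 < d by rewrite divr_gt0 ?exprn_gt0//; lra.
have dv : d * (3 + K) = v ^+ 2 by rewrite divfK// gt_eqF//; lra.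
have vv : v ^+ 2 <= v by rewrite expr2; nra.
have dle : d <= v by nra.
pose gs (o : option I) := if o is Some i then fs i else a0.
have [z [r [Hz zK zg za rlt]]] := hull_approx gs G0 K0 FK d0.
have [|w Mw [w1 w2]] := gap_approx hc hl hge hs Xc (z0 := z) v0.
  apply: le_lt_trans (hull_epi Hz) _; rewrite lte_fin -dv.
  have /= := zg None; rewrite ltr_norml => /andP[za0 _].
  have := dual_ge (z.2 - a0) z.1; rewrite dualBE.
  have : `|z.2 - a0| * `|z.1| <= d * (K + d) by apply: ler_pM => //; exact: ltW.
  nra.
have w1' : `|w.1| <= `|z.1| + 6 * v.
  by have := ler_normD (w.1 - z.1) z.1; rewrite subrK; lra.
exists w; split => //; first lra.
  move=> i; have /= := zg (Some i).
  have := dual_bound (fs i) (w.1 - z.1); rewrite (linB (dval_lin _)).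
  have : `|fs i| * `|w.1 - z.1| <= L * (6 * v) by apply: ler_pM.
  have := ler_normD (fs i w.1 - fs i z.1) (fs i z.1 - F0 (fs i)).
  rewrite addrA subrK; nra.
have := ler_normD (w.2 - z.2) (z.2 - a0); rewrite addrA subrK; nra.
Qed.

Theorem contact_gossez_D : gossez_D (contact h).
Proof.
split; first exact: contact_maximal.
move=> [F0 a0] G0; have [B HB] := gossez_contact_approx G0.
have ex (i : seq D * nat) : exists z, [/\ contact h z, `|z.1| <= B,
    forall f, f \in i.1 -> `|f z.1 - F0 f| < i.2.+1%:R^-1 & `|z.2 - a0| < i.2.+1%:R^-1].
  have e0 : 0 < i.2.+1%:R^-1 :> R by rewrite invr_gt0.
  have [z [Mz zB zf za]] := HB 'I_(size i.1) (fun k => nth 0 i.1 k) _ e0.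
  exists z; split => // f fi.
  have fi' : (index f i.1 < size i.1)%N by rewrite index_mem.
  by have := zf (Ordinal fi'); rewrite /= nth_index.
have [net netP] := choice ex.
(* Indices are finite lists of functionals with a precision; enlarging either refines the
   approximation, and [B] bounds the net uniformly. *)
exists (seq D * nat)%type, (fun i j => {subset i.1 <= j.1} /\ (i.2 <= j.2)%N), net.
split; first by exists ([::], 0%N).
split; first by move=> i; split.
split.
  move=> i j k [ij1 ij2] [jk1 jk2]; split; last exact: leq_trans jk2.
  by move=> f /ij1; exact: jk1.
split.
  move=> i j; exists (i.1 ++ j.1, maxn i.2 j.2); split; split => /=.
  - by move=> f fi; rewrite mem_cat fi.
  - exact: leq_maxl.
  - by move=> f fj; rewrite mem_cat fj orbT.
  - exact: leq_maxr.
split; first by move=> i; have [] := netP i.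
split.
  exists (`|B| + (`|a0| + 1)) => i; have [_ zB _ za] := netP i; split.
    by apply: (le_trans zB); apply: (le_trans (ler_norm _)); rewrite lerDl addr_ge0.
  have a2 : `|(net i).2| <= `|a0| + 1.
    have := ler_normD ((net i).2 - a0) a0; rewrite subrK.
    have i1 : i.2.+1%:R^-1 <= 1 :> R by rewrite invf_le1// ler1n.
    by have := lt_le_trans za i1; lra.
  move=> x; apply: (le_trans (dual_bound _ _)); rewrite ler_wpM2r//.
  by apply: (le_trans a2); rewrite lerDr.
move=> n fs e e0.
have [m me] : exists m : nat, m.+1%:R^-1 < e.
  exists (Num.bound e^-1); rewrite invf_plt ?posrE//.
  apply: lt_trans (archi_boundP _) _; first by rewrite invr_ge0 ltW.
  by rewrite ltr_nat.
exists ([seq fs k | k <- enum 'I_n], m) => i [i1 i2]; have [_ _ zf za] := netP i.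
have ie : i.2.+1%:R^-1 < e.
  by apply: le_lt_trans me; rewrite lef_pV2 ?posrE// ler_nat ltnS.
split=> [k|].
  by apply: lt_trans ie; apply: zf; apply: i1; rewrite /= map_f// mem_enum.
exists `|(net i).2 - a0|; split; first exact: lt_trans ie.
by move=> x; rewrite -dualBE; exact: dual_bound.
Qed.

End ContactGossez.

(** * Baire's theorem on closed subsets and an open mapping theorem for convex sets *)

Section BaireOpenMapping.
Variable R : realType.

Definition seq_closed (E : normedModType R) (A : set E) :=
  forall x, (forall e, 0 < e -> exists2 y, A y & `|x - y| < e) -> A x.

(** Balls centred in [L], the one built at stage n avoiding [C n]; the radii at least halve, so the
    centres converge geometrically to a point of [L] in no [C n]. *)
Lemma baire_cover (E : normedModType R) (L : set E) (C : nat -> set E) :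
  geo_complete E -> seq_closed L -> L !=set0 -> (forall n, seq_closed (C n)) ->
  (forall x, L x -> exists n, C n x) ->
  exists n x r, [/\ L x, 0 < r & forall y, L y -> `|y - x| < r -> C n y].
Proof.
move=> Ec Lc [x0 Lx0] Cc LC; apply: contrapT => H.
have step (n : nat) (p : E * R) : exists p' : E * R, L p.1 -> 0 < p.2 ->
    [/\ L p'.1, 0 < p'.2, `|p'.1 - p.1| <= p.2 / 2, p'.2 <= p.2 / 2 &
        forall w, `|w - p'.1| <= p'.2 -> ~ C n w].
  have [[Lp p0]|nLp] := pselect (L p.1 /\ 0 < p.2); last by exists p => ? ?; case: nLp.
  have p2 : 0 < p.2 / 2 by lra.
  have [y [Ly yp nCy]] : exists y, [/\ L y, `|y - p.1| < p.2 / 2 & ~ C n y].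
    apply: contrapT => nE; apply: H; exists n, p.1, (p.2 / 2); split=> // y Ly yp.
    by apply: contrapT => nC; apply: nE; exists y.
  have [e e0 He] : exists2 e, 0 < e & forall w, C n w -> e <= `|y - w|.
    apply: contrapT => nE; apply/nCy/Cc => e e0; apply: contrapT => nw.
    apply: nE; exists e => // w Cw; rewrite leNgt; apply/negP => lt.
    by apply: nw; exists w.
  exists (y, Num.min (e / 2) (p.2 / 2)) => _ _ /=; split=> //.
  - by rewrite lt_min p2 andbT; lra.
  - exact: ltW.
  - by rewrite ge_min lexx orbT.
  - move=> w; rewrite le_min distrC => /andP[we _] /He; lra.
have [f fP] := choice (fun np : nat * (E * R) => step np.1 np.2).
pose u := fix u n := if n is n'.+1 then f (n', u n') else (x0, 1).
have uP n : L (u n).1 /\ 0 < (u n).2.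
  by elim: n => [//|n [IH1 IH2]]; have [] := fP (n, u n) IH1 IH2.
have uS n := fP (n, u n) (uP n).1 (uP n).2.
have ur n k : (u (n + k)%N).2 <= (u n).2 * 2^-1 ^+ k.
  elim: k => [|k IH]; first by rewrite addn0 expr0 mulr1.
  rewrite addnS exprS; have [_ _ _ + _] := uS (n + k)%N; move=> /=; lra.
have ud n k : `|(u (n + k.+1)%N).1 - (u (n + k)%N).1| <= (u n).2 / 2 * 2^-1 ^+ k.
  rewrite addnS; have [_ _ + _ _] := uS (n + k)%N; have := ur n k; move=> /=; lra.
have [n|l lP] := Ec (fun n => (u n).1) (1 / 2); first exact: (ud 0%N n).
have lu n : `|l - (u n).1| <= (u n).2.
  apply/ler_addgt0Pr => e e0; have [N HN] := geo_small (2 * (1 / 2)) e0.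
  have := @geo_dist R E (fun k => (u (n + k)%N).1) _ (ud n) 0%N N.
  rewrite add0n addn0 expr0 => h1.
  have h2 := le_lt_trans (lP (n + N)%N) (HN _ (leq_addl _ _)).
  have := ler_distD (u (n + N)%N).1 l (u n).1; lra.
have Ll : L l.
  apply: Lc => e e0; have [N /(_ N (leqnn N)) HN] := geo_small (2 * (1 / 2)) e0.
  exists (u N).1; first exact: (uP N).1.
  exact: le_lt_trans (lP N) HN.
have [n Cl] := LC _ Ll; have [_ _ _ _ /(_ l (lu n.+1))] := uS n; exact.
Qed.

(** With v_0 = y and v_(n+1) = 2 (v_n - f(g(v_n))), the sum of 2^-(n+1) f(g(v_n)) telescopes to y/2.
    The weights add up to 1, so convexity and closedness keep the series of preimages in [Q]; hence
    the factor 1/2. *)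
Lemma cvx_open_mapping (Z Y : normedModType R) (f : {linear Z -> Y}) (K N r : R)
    (Q : set Z) (L : set Y) :
  geo_complete Z -> (forall z, `|f z| <= K * `|z|) ->
  cvx_set Q -> seq_closed Q -> (forall z, Q z -> `|z| <= N) ->
  (forall y z, L y -> Q z -> L ((2 : R) *: (y - f z))) ->
  (forall y e, L y -> `|y| < r -> 0 < e -> exists2 z, Q z & `|y - f z| < e) ->
  forall y, L y -> `|y| < r -> exists2 z, Q z & f z = (2^-1 : R) *: y.
Proof.
move=> Zc fK Qc Qcl QN Lf Lr y Ly yr.
have r0 : 0 < r by apply: le_lt_trans yr.
have step (y' : Y) : exists z, L y' -> `|y'| < r -> Q z /\ `|y' - f z| < r / 2.
  have [[Ly' yr']|nLy] := pselect (L y' /\ `|y'| < r); last by exists 0 => ? ?; case: nLy.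
  have [|z Qz yz] := Lr y' (r / 2) Ly' yr'; first lra.
  by exists z.
have [g gP] := choice step.
pose v := fix v n := if n is n'.+1 then (2 : R) *: (v n' - f (g (v n'))) else y.
have vP n : L (v n) /\ `|v n| < r.
  elim: n => [//|n [IH1 IH2]] /=; have [Qg vg] := gP _ IH1 IH2; split; first exact: Lf.
  by rewrite normrZ ger0_norm//; lra.
have Qg n : Q (g (v n)) by have [h1 h2] := vP n; have [] := gP _ h1 h2.
pose s := fix s n := if n is n'.+1 then s n' + (2^-1 ^+ n : R) *: g (v n') else 0.
have sS n : s n.+1 = s n + (2^-1 ^+ n.+1 : R) *: g (v n) by [].
(* The weights 1/2, ..., 2^-n leave exactly 2^-n for [q]. *)
have sQ n q : Q q -> Q (s n + (2^-1 ^+ n : R) *: q).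
  elim: n q => [|n IH] q Qq; first by rewrite /= expr0 scale1r add0r.
  have h2 : 0 < (2^-1 : R) < 1 by lra.
  have := IH _ (Qc _ _ _ (Qg n) Qq h2); rewrite (_ : 1 - 2^-1 = 2^-1 :> R); last lra.
  by rewrite scalerDr !scalerA -exprSr addrA -sS.
have sd n : `|s n.+1 - s n| <= N / 2 * 2^-1 ^+ n.
  rewrite sS addrAC subrr add0r normrZ ger0_norm ?exprn_ge0// exprS.
  have : (2^-1 : R) ^+ n * `|g (v n)| <= 2^-1 ^+ n * N.
    by apply: ler_wpM2l; [rewrite exprn_ge0|exact: QN].
  lra.
have fs n : f (s n) = (2^-1 : R) *: y - (2^-1 ^+ n.+1 : R) *: v n.
  elim: n => [|n IH]; first by rewrite /= linear0 expr1 subrr.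
  rewrite sS linearD linearZ IH [v n.+1]/((2 : R) *: (v n - f (g (v n)))).
  rewrite (exprSr _ n.+1) scalerA -mulrA mulVf// mulr1 scalerBr opprB.
  by rewrite -addrA; congr (_ + _); rewrite addrC.
have [l lP] := Zc _ _ sd.
have N0 : 0 <= N by apply: le_trans (QN _ (Qg 0%N)).
exists l.
  apply: Qcl => e e0; have [n /(_ n (leqnn n)) Hn] := geo_small (2 * N) e0.
  exists (s n + (2^-1 ^+ n : R) *: g (v n)); first exact: sQ.
  rewrite opprD addrA; apply: le_lt_trans (ler_normB _ _) _; apply: le_lt_trans Hn.
  rewrite normrZ ger0_norm ?exprn_ge0//; have := lP n.
  have : (2^-1 : R) ^+ n * `|g (v n)| <= 2^-1 ^+ n * N.
    by apply: ler_wpM2l; [rewrite exprn_ge0|exact: QN].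
  lra.
apply/eqP; rewrite -subr_eq0 -normr_le0; apply/ler_addgt0Pr => e e0; rewrite add0r.
have K0 : 0 <= `|K| by [].
have [n /(_ n (leqnn n)) Hn] := geo_small (`|K| * N + r) e0.
apply: le_trans (ltW Hn).
have -> : f l - (2^-1 : R) *: y = f (l - s n) - (2^-1 ^+ n.+1 : R) *: v n.
  by rewrite linearB fs opprB addrA [RHS]addrAC addrK.
apply: (le_trans (ler_normB _ _)); rewrite normrZ ger0_norm ?exprn_ge0// exprS.
have h1 : `|f (l - s n)| <= `|K| * (N * 2^-1 ^+ n).
  apply: (le_trans (fK _)); apply: (@le_trans _ _ (`|K| * `|l - s n|)).
    by rewrite ler_wpM2r// ler_norm.
  by rewrite ler_wpM2l//; have := lP n; lra.
have h2 : (2^-1 : R) ^+ n * `|v n| <= 2^-1 ^+ n * r.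
  by apply: ler_wpM2l; [rewrite exprn_ge0|exact: ltW (vP n).2].
have h3 : 0 <= (2^-1 : R) ^+ n * `|v n| by rewrite mulr_ge0// exprn_ge0.
lra.
Qed.

End BaireOpenMapping.

(** * Splitting of the conjugate under the interior condition *)

Section ConjugateSplitting.
Variables (R : realType) (X : normedModType R).
Local Notation D := (dual X).
Implicit Types (hS hT : X * D -> \bar R).

(** The inequality (hS [] hT)^*(a, F) <= r; [conj_split] is hS^*(a, U) + hT^*(a, V) <= r for some U
    + V = F. Both are stated on real points of epigraphs. *)
Definition conj_bounded hS hT (a : D) (F : bidual X) (r : R) :=
  forall u w b s t, (hS (u, b) <= s%:E)%E -> (hT (w, b) <= t%:E)%E ->
    a (u + w) + F b - (s + t) <= r.

Definition conj_split hS hT (a : D) (F : bidual X) (r : R) :=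
  exists U V : bidual X, (forall f, U f + V f = F f) /\
    forall z w s t, (hS z <= s%:E)%E -> (hT w <= t%:E)%E ->
      (a z.1 + U z.2 - s) + (a w.1 + V w.2 - t) <= r.

Lemma lt_pinfty_real (x : \bar R) : (x < +oo)%E -> exists r : R, (x <= r%:E)%E.
Proof. by case: x => [r| |]// _; [exists r|exists 0; rewrite leNye]. Qed.

Lemma sublevel_cvx hS (N : R) : convex_fun hS -> cvx_set [set z | (hS z <= N%:E)%E].
Proof.
move=> hc x y t /= hx hy t01; have := @epi_cvx R X hS hc (x, N) (y, N) t hx hy t01.
rewrite /= (_ : _ (t *: N) ((1 - t) *: N) = N)//.
by transitivity (t * N + (1 - t) * N); [|ring].
Qed.

Lemma sublevel_closed hS (N : R) : nlsc hS -> seq_closed [set z | (hS z <= N%:E)%E].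
Proof.
move=> hl z Hz /=; rewrite leNgt; apply/negP => /hl[e [e0 He]].
have [w /= hw zw] := Hz e e0; have : nclose z w e.
  by apply/ncloseP; move: zw; rewrite prod_normE gt_max => /andP[].
by move=> /He; rewrite ltNge hw.
Qed.

Lemma ball_cvx (E : normedModType R) (N : R) : cvx_set [set z : E | `|z| <= N].
Proof.
move=> x y t /= xN yN /andP[t0 t1]; apply: (le_trans (ler_normD _ _)).
rewrite !normrZ (gtr0_norm t0) (@gtr0_norm _ (1 - t)) ?subr_gt0//; nra.
Qed.

Lemma ball_closed (E : normedModType R) (N : R) : seq_closed [set z : E | `|z| <= N].
Proof.
move=> x Hx /=; apply/ler_addgt0Pr => e e0; have [y /= yN xy] := Hx e e0.
by have := ler_normD (x - y) y; rewrite subrK; lra.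
Qed.

Lemma aff2 (A : set (X -> R)) (f g : X -> R) (c : R) : A f -> A g ->
  aff A (fun x => c * f x + (1 - c) * g x).
Proof.
move=> Af Ag; exists 2%N, (fun i : 'I_2 => if i == ord0 then c else 1 - c),
  (fun i : 'I_2 => if i == ord0 then f else g).
split; first by rewrite big_ord_recl big_ord1 /=; ring.
split; first by move=> i; case: ifP.
by apply/funext => x; rewrite big_ord_recl big_ord1.
Qed.

Lemma affS (A B : set (X -> R)) : A `<=` B -> aff A `<=` aff B.
Proof. by move=> AB f [n [c [d [c1 [Ad ->]]]]]; exists n, c, d; split=> //; split=> // i; exact: AB. Qed.

Lemma lin_bound_of_affine (E : normedModType R) (l : E -> R) (K B : R) : lin_fun l ->
  (forall v, l v <= K * `|v| + B) -> forall v, `|l v| <= K * `|v|.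
Proof.
move=> ll lB; suff H v : l v <= K * `|v|.
  by move=> v; rewrite ler_norml H andbT lerNl -(linN ll) -(normrN v) H.
rewrite leNgt; apply/negP => lt; set g := l v - K * `|v|.
have g0 : 0 < g by rewrite /g; lra.
pose t := (`|B| + 1) / g; have t0 : 0 < t by rewrite divr_gt0//; have := normr_ge0 B; lra.
have := lB (t *: v); rewrite (linZ ll) normrZ (gtr0_norm t0).
have : t * g = `|B| + 1 by rewrite divfK// gt_eqF.
rewrite /g; have := ler_norm B; lra.
Qed.

Section InteriorCondition.
Variables (hS hT : X * D -> \bar R).
Hypotheses (Sc : convex_fun hS) (Tc : convex_fun hT) (Sl : nlsc hS) (Tl : nlsc hT).
Hypothesis Xc : geo_complete X.
Hypothesis dom_ne : pr_dual_dom hS `&` pr_dual_dom hT !=set0.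
Hypothesis dom_ic : ic (dset_diff (pr_dual_dom hS) (pr_dual_dom hT)) (fun _ => 0).

Let Z : normedModType R := ((X * D) * (X * D))%type.
Let diff (z : Z) : D := z.1.2 - z.2.2.

Let diff_linear : linear diff.
Proof. by move=> t x y; rewrite /diff /= scalerBr opprD addrACA. Qed.
HB.instance Definition _ := GRing.isLinear.Build R Z D _ diff diff_linear.

Let diff_comb (s t : R) z w : diff (s *: z + t *: w) = s *: diff z + t *: diff w.
Proof. by rewrite /diff /= !scalerBr opprD addrACA. Qed.

Let diff_bound z : `|diff z| <= 2 * `|z|.
Proof.
apply: (le_trans (ler_normB _ _)).
have h1 : `|z.1.2| <= `|z| by rewrite !prod_normE !le_max lexx !orbT.
have h2 : `|z.2.2| <= `|z| by rewrite !prod_normE !le_max lexx !orbT.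
lra.
Qed.

Let Dd := dset_diff (pr_dual_dom hS) (pr_dual_dom hT).
(** Under the interior condition this is a closed linear subspace ([L_scale], [L_add], [L_closed]),
    on which Baire's theorem is used. *)
Let L : set D := [set y | aff Dd (dval y)].
Let dom (z : Z) (N : R) := (hS z.1 <= N%:E)%E /\ (hT z.2 <= N%:E)%E.

Let domW z N N' : N <= N' -> dom z N -> dom z N'.
Proof. by move=> NN [h1 h2]; split; [apply: le_trans h1 _|apply: le_trans h2 _]; rewrite lee_fin. Qed.

Let DdP (y : D) : Dd (dval y) -> exists z N, diff z = y /\ dom z N.
Proof.
move=> [a [b [[x /lt_pinfty_real[r hr]] [[u /lt_pinfty_real[s hs]] yE]]]].
exists ((x, a), (u, b)), (Num.max r s); split.
  by apply: dual_ext => v; rewrite dualBE yE.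
by split; [apply: le_trans hr _|apply: le_trans hs _]; rewrite lee_fin le_max lexx ?orbT.
Qed.

Let dom_Dd z N : dom z N -> Dd (dval (diff z)).
Proof.
move=> [h1 h2]; exists z.1.2, z.2.2; split; last split.
- by exists z.1.1; apply: le_lt_trans (ltry N); case: z.1 h1.
- by exists z.2.1; apply: le_lt_trans (ltry N); case: z.2 h2.
- by apply/funext => v; rewrite /diff dualBE.
Qed.

Let base : exists z N, diff z = 0 /\ dom z N.
Proof.
have [a [[x /lt_pinfty_real[r hr]] [u /lt_pinfty_real[s hs]]]] := dom_ne.
exists ((x, a), (u, a)), (Num.max r s); split; first exact: subrr.
by split; [apply: le_trans hr _|apply: le_trans hs _]; rewrite lee_fin le_max lexx ?orbT.
Qed.

Let Dd0 : Dd (dval (0 : D)).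
Proof. by have [z [N [<- /dom_Dd]]] := base. Qed.

Let L_scale_Dd (y : D) (c : R) : Dd (dval y) -> L (c *: y).
Proof.
move=> Dy; have E : dval (c *: y) = fun x => c * y x + (1 - c) * (0 : D) x.
  by apply/funext => x; rewrite dualZE dual0E; ring.
by change (aff Dd (dval (c *: y))); rewrite E; exact: aff2.
Qed.

Let Dd_L y : Dd (dval y) -> L y.
Proof. by move=> Dy; rewrite -(scale1r y); exact: L_scale_Dd. Qed.

Let L_absorb (y : D) : L y -> exists2 d, 0 < d & Dd (dval (d *: y)).
Proof.
move=> Ly; have [_ /(_ (dval y))[]] := dom_ic.
  apply: affS Ly => f Df; exists f, (dval (0 : D)); split=> //; split=> //.
  by apply/funext => x; rewrite dual0E subr0.
move=> d [d0 /(_ d)]; rewrite ltW// lexx => /(_ isT) Dd'; exists d => //.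
suff <- : (fun x => 0 + d * y x) = dval (d *: y) by [].
by apply/funext => x; rewrite add0r.
Qed.

Let L_scale c y : L y -> L (c *: y).
Proof.
move=> /L_absorb[d d0 Dy]; rewrite (_ : c *: y = (c / d) *: (d *: y)); last first.
  by rewrite scalerA divfK// gt_eqF.
exact: L_scale_Dd.
Qed.

Let dom_comb z w N t : dom z N -> dom w N -> 0 < t < 1 -> dom (t *: z + (1 - t) *: w) N.
Proof. by move=> [z1 z2] [w1 w2] t01; split; exact: sublevel_cvx. Qed.

Let Dd_comb (y y' : D) t : Dd (dval y) -> Dd (dval y') -> 0 < t < 1 ->
  Dd (dval (t *: y + (1 - t) *: y')).
Proof.
move=> /DdP[z [N [<- zN]]] /DdP[w [N' [<- wN]]] t01; rewrite -diff_comb.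
apply: (@dom_Dd _ (Num.max N N')); apply: dom_comb => //.
  by apply: domW zN; rewrite le_max lexx.
by apply: domW wN; rewrite le_max lexx orbT.
Qed.

Let L_add y y' : L y -> L y' -> L (y + y').
Proof.
move=> /L_absorb[d d0 Dy] /L_absorb[e e0 Dy'].
have de0 : 0 < d + e by lra.
have t01 : 0 < e / (d + e) < 1 by rewrite divr_gt0//= ltr_pdivrMr// mul1r; lra.
have -> : y + y' = ((d + e) / (d * e)) *:
    (e / (d + e) *: (d *: y) + (1 - e / (d + e)) *: (e *: y')).
  rewrite scalerDr !scalerA; congr (_ + _).
    by rewrite -[LHS]scale1r; congr (_ *: _); field; rewrite !gt_eqF.
  by rewrite -[LHS]scale1r; congr (_ *: _); field; rewrite !gt_eqF.
by apply: L_scale_Dd; exact: Dd_comb.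
Qed.

Let L_closed : seq_closed L.
Proof.
move=> y Hy; have [aff_closed _] := dom_ic; apply: aff_closed => e e0.
have [w Lw yw] := Hy e e0; exists (dval w); split=> //.
exists `|y - w|; split=> // x; rewrite -dualBE; exact: dual_bound.
Qed.

Let Q (N : R) : set Z := [set z | `|z| <= N /\ dom z N].

Let Q_cvx N : cvx_set (Q N).
Proof.
move=> x y t [xN xd] [yN yd] t01; split; last exact: dom_comb.
exact: (@ball_cvx Z N x y t).
Qed.

Let Q_closed N : seq_closed (Q N).
Proof.
move=> z Hz; split; first by apply: ball_closed => e /Hz[w [wN _] zw]; exists w.
split.
  apply: (@sublevel_closed hS N Sl) => e /Hz[w [_ [wS _]] zw]; exists w.1 => //.
  by apply: le_lt_trans zw; rewrite [leRHS]prod_normE le_max lexx.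
apply: (@sublevel_closed hT N Tl) => e /Hz[w [_ [_ wT]] zw]; exists w.2 => //.
by apply: le_lt_trans zw; rewrite [leRHS]prod_normE le_max lexx orbT.
Qed.

Let QW z N N' : N <= N' -> Q N z -> Q N' z.
Proof. by move=> NN [h1 h2]; split; [exact: le_trans NN|exact: domW h2]. Qed.

Let L_cover (y : D) : L y -> exists (n : nat) z, Q n%:R z /\ diff z = (n.+1%:R^-1 : R) *: y.
Proof.
move=> /L_absorb[d d0 /DdP[z [N [zE zN]]]]; have [z0 [N0 [z0E z0N]]] := base.
pose B := `|z| + `|z0| + `|N| + `|N0| + d^-1.
have di : 0 < d^-1 by rewrite invr_gt0.
have := archi_boundP (_ : 0 <= B); set n := Num.bound B => /(_ ltac:(by rewrite !addr_ge0// ltW)) Bn.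
have [nz nz0 nN nN0] : [/\ `|z| <= n%:R, `|z0| <= n%:R, N <= n%:R & N0 <= n%:R].
  have := ler_norm N; have := ler_norm N0; have := normr_ge0 z; have := normr_ge0 z0.
  have := normr_ge0 N; have := normr_ge0 N0; move: Bn; rewrite /B.
  by move=> *; split; lra.
have n0 : 0 < n.+1%:R :> R by rewrite ltr0n.
(* The pair over 0 takes the remaining weight; the summand [d^-1] of [B] makes t < 1. *)
pose t := (n.+1%:R * d)^-1.
have t01 : 0 < t < 1.
  rewrite /t invr_gt0 mulr_gt0//= invf_lt1 ?mulr_gt0// -ltr_pdivrMr// mul1r -natr1.
  have := normr_ge0 N; have := normr_ge0 N0; have := normr_ge0 z; have := normr_ge0 z0.
  by move: Bn; rewrite /B; lra.
exists n, (t *: z + (1 - t) *: z0); split.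
  by apply: Q_cvx => //; split=> //; [exact: domW zN|exact: domW z0N].
rewrite diff_comb zE z0E scaler0 addr0 scalerA; congr (_ *: _).
by rewrite /t invfM divfK// gt_eqF.
Qed.

(** Baire gives a ball of [L] around some [x]; mixing with a preimage of a negative multiple of [x],
    in the ratio a : b that cancels [x], recentres it at 0. *)
Let L_approx : exists N r, 0 < r /\ forall y e, L y -> `|y| < r -> 0 < e ->
  exists2 z, Q N z & `|y - diff z| < e.
Proof.
pose C (n : nat) : set D := [set y | forall e, 0 < e ->
  exists2 z, Q n%:R z & `|(n.+1%:R^-1 : R) *: y - diff z| < e].
have [|||||n [x [r [Lx r0 HC]]]] := @baire_cover R D L C.
- exact: dual_geo.
- exact: L_closed.
- by exists 0; exact: Dd_L.
- move=> n y Hy e e0; have e2 : 0 < e / 2 by lra.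
  have [w Cw yw] := Hy _ e2; have [z Qz wz] := Cw _ e2; exists z => //.
  rewrite (_ : _ - _ = (n.+1%:R^-1 : R) *: (y - w) + ((n.+1%:R^-1 : R) *: w - diff z)); last first.
    by rewrite scalerBr addrA subrK.
  apply: le_lt_trans (ler_normD _ _) _.
  have i1 : n.+1%:R^-1 <= 1 :> R by rewrite invf_le1// ler1n.
  have i0 : 0 <= n.+1%:R^-1 :> R by rewrite invr_ge0.
  rewrite normrZ (ger0_norm i0).
  by rewrite [ltRHS](splitr e); apply: ltrD wz; apply: le_lt_trans yw; rewrite ler_piMl.
- move=> y /L_cover[n [z [Qz zE]]]; exists n => e e0; exists z => //.
  by rewrite zE subrr normr0.
have [m [w [Qw wE]]] := L_cover (L_scale (-1) Lx).
pose a : R := n.+1%:R; pose b : R := m.+1%:R.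
have a0 : 0 < a by rewrite ltr0n.
have b0 : 0 < b by rewrite ltr0n.
have ab0 : 0 < a + b by lra.
pose t := a / (a + b).
have t01 : 0 < t < 1 by rewrite /t divr_gt0//= ltr_pdivrMr// mul1r; lra.
have t1 : 1 - t = b / (a + b) by rewrite /t; field; rewrite gt_eqF.
exists (n + m)%:R, (r / (a + b)); split; first exact: divr_gt0.
move=> y e Ly yr e0.
have Ly' : L (x + (a + b) *: y) by apply: L_add => //; exact: L_scale.
have [|z Qz zy] := HC _ Ly' _ e e0.
  by rewrite addrAC subrr add0r normrZ gtr0_norm// mulrC -ltr_pdivlMr.
exists (t *: z + (1 - t) *: w).
  by apply: Q_cvx => //; [apply: QW Qz|apply: QW Qw]; rewrite ler_nat ?leq_addr ?leq_addl.
rewrite diff_comb wE -/b.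
have E1 : t *: (a^-1 *: (x + (a + b) *: y)) = (a + b)^-1 *: x + y.
  rewrite scalerA (_ : t * a^-1 = (a + b)^-1); last by rewrite /t; field; rewrite !gt_eqF.
  by rewrite scalerDr scalerA mulVf ?gt_eqF// scale1r.
have E2 : (1 - t) *: (b^-1 *: (-1 *: x)) = - ((a + b)^-1 *: x).
  rewrite t1 !scalerA mulrN1 (_ : b / (a + b) * b^-1 = (a + b)^-1) ?scaleNr//.
  by field; rewrite !gt_eqF.
rewrite E2 (_ : y - _ = t *: (a^-1 *: (x + (a + b) *: y) - diff z)); last first.
  by rewrite [RHS]scalerBr E1 opprB addrA (addrC y).
rewrite normrZ gtr0_norm; last by case/andP: t01.
apply: le_lt_trans zy; rewrite ler_piMl//; lra.
Qed.

Let L_open : exists N r, 0 < r /\ forall y, L y -> `|y| < r ->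
  exists2 z, Q N z & diff z = (2^-1 : R) *: y.
Proof.
have [N [r [r0 H]]] := L_approx; exists N, r; split=> //.
apply: (@cvx_open_mapping R Z D diff 2 N r (Q N) L) => //.
- by apply: prod_geo; apply: prod_geo => //; exact: dual_geo.
- by move=> z [].
- move=> y z Ly [_ /dom_Dd/Dd_L Lz]; apply: L_scale; apply: L_add => //.
  by rewrite -scaleN1r; exact: L_scale.
Qed.

(** The heights of [A] over y form a marginal function: at least -r over 0 by hypothesis, bounded
    above on a small ball of [L] by [L_open], hence by convexity at least -r - C |y|. The functional
    [G] is a multiplier for the constraint [z.1.2 = z.2.2], whence U = F + G and V = -G. *)
Lemma interior_conj_split (a : D) (F : bidual X) (r : R) :
  conj_bounded hS hT a F r -> conj_split hS hT a F r.
Proof.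
move=> Hr; have [N [d [d0 HN]]] := L_open; have [MF MF0 FM] := bidual_bound F.
have [zb [Nb [zb0 zbN]]] := base.
pose val (z : Z) : R := a z.1.1 + a z.2.1 + F z.1.2.
have comb (t b1 b2 b3 c1 c2 c3 : R) :
    t * b1 + (1 - t) * c1 + (t * b2 + (1 - t) * c2) + (t * b3 + (1 - t) * c3) =
    t * (b1 + b2 + b3) + (1 - t) * (c1 + c2 + c3) by ring.
have comb' (t b1 b2 b3 c1 c2 c3 : R) :
    t * (b1 + b2 - b3) + (1 - t) * (c1 + c2 - c3) =
    t * b1 + (1 - t) * c1 + (t * b2 + (1 - t) * c2) - (t * b3 + (1 - t) * c3) by ring.
have valc (z w : Z) (t : R) : val (t *: z + (1 - t) *: w) = t * val z + (1 - t) * val w.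
  transitivity (a (t *: z.1.1 + (1 - t) *: w.1.1) + a (t *: z.2.1 + (1 - t) *: w.2.1)
    + F (t *: z.1.2 + (1 - t) *: w.1.2)); first by [].
  rewrite !(linD (dval_lin _)) !(linZ (dval_lin _)) (linD (bidual_lin F)) !(linZ (bidual_lin F)) /val.
  exact: comb.
pose A : set (D * R) := [set p | exists (z : Z) s t, [/\ p.1 = diff z,
  (hS z.1 <= s%:E)%E, (hT z.2 <= t%:E)%E & p.2 = s + t - val z]].
have Ac : cvx_set A.
  move=> [y1 p1] [y2 p2] t [z [s1 [t1 [/= -> S1 T1 ->]]]] [w [s2 [t2 [/= -> S2 T2 ->]]]] t01.
  exists (t *: z + (1 - t) *: w), (t * s1 + (1 - t) * s2), (t * t1 + (1 - t) * t2).
  split; first by rewrite diff_comb.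
  - exact: (@epi_cvx R X hS Sc (z.1, s1) (w.1, s2) t S1 S2 t01).
  - exact: (@epi_cvx R X hT Tc (z.2, t1) (w.2, t2) t T1 T2 t01).
  - by rewrite valc; exact: comb'.
have A0 y p : A (y, p) -> y = 0 -> - r <= p.
  move=> [[[u b] [w b']] [s [t [/= yE Ss Tt ->]]]] y0.
  have bb : b = b' by apply/eqP; rewrite -subr_eq0 -[X in X == 0]yE y0.
  have := Hr u w b s t Ss; rewrite {1}bb => /(_ Tt); rewrite (linD (dval_lin a)) /val /=; lra.
pose B := 2 * N + 2 * `|a| * N + MF * N.
have AQ z : Q N z -> exists2 p, A (diff z, p) & p <= B.
  move=> [zN [S T]]; exists (N + N - val z); first by exists z, N, N.
  have n1 : `|z.1.1| <= N by apply: le_trans zN; rewrite !prod_normE !le_max lexx.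
  have n2 : `|z.2.1| <= N by apply: le_trans zN; rewrite !prod_normE !le_max lexx !orbT.
  have n3 : `|z.1.2| <= N by apply: le_trans zN; rewrite !prod_normE !le_max lexx !orbT.
  have := dual_ge a z.1.1; have := dual_ge a z.2.1.
  have := FM z.1.2; rewrite ler_norml => /andP[+ _].
  have := ler_wpM2l (normr_ge0 a) n1; have := ler_wpM2l (normr_ge0 a) n2.
  have := ler_wpM2l (ltW MF0) n3; rewrite /val /B; lra.
pose C := 4 * `|B + r| / d.
have C0 : 0 <= C by rewrite divr_ge0 ?mulr_ge0// ltW.
have [||[y p] Ayp /=|l [ll lP]] := @sandwich R D A (fun y => C * `|y|) (- r).
- exact: Ac.
- by apply: cvx_funZ => //; apply: cvx_fun_norm.
- have [y0|y0] := eqVneq y 0; first by rewrite y0 normr0 mulr0 addr0; exact: A0 Ayp y0.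
  have ny : 0 < `|y| by rewrite normr_gt0.
  (* A preimage of -(c/2) y balances [y]; [t] and [1 - t] bring the combination over 0, where the
     lower bound is known. *)
  pose c := d / (2 * `|y|); have c0 : 0 < c by rewrite divr_gt0//; lra.
  have Ly : L y.
    by have [z [s [t [/= -> Ss Tt _]]]] := Ayp; apply: Dd_L; apply: (@dom_Dd _ (Num.max s t));
      split; [apply: le_trans Ss _|apply: le_trans Tt _]; rewrite lee_fin le_max lexx ?orbT.
  have [||z Qz zE] := HN (- c *: y); first exact: L_scale.
    rewrite normrZ normrN gtr0_norm//.
    have -> : c * `|y| = d / 2 by rewrite /c; field; rewrite gt_eqF.
    lra.
  have [p' Ap' p'B] := AQ z Qz.
  have c2 : 0 < 1 + c / 2 by lra.
  pose t := (c / 2) / (1 + c / 2).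
  have t01 : 0 < t < 1.
    by apply/andP; split; [apply: divr_gt0; lra|rewrite ltr_pdivrMr//; lra].
  have t1 : 1 - t = (1 + c / 2)^-1.
    by rewrite /t; field; rewrite gt_eqF//; lra.
  have Acomb : A (t *: y + (1 - t) *: diff z, t * p + (1 - t) * p') by exact: (Ac _ _ _ Ayp Ap' t01).
  have yz0 : t *: y + (1 - t) *: diff z = 0.
    rewrite zE !scalerA -scalerDl t1 /t.
    have -> : c / 2 / (1 + c / 2) + (1 + c / 2)^-1 / 2 * - c = 0.
      by field; rewrite gt_eqF//; lra.
    exact: scale0r.
  have H := A0 _ _ Acomb yz0.
  have H2 : - r * (1 + c / 2) <= c / 2 * p + p'.
    have E : (t * p + (1 - t) * p') * (1 + c / 2) = c / 2 * p + p'.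
      by rewrite t1 /t; field; rewrite gt_eqF//; lra.
    by rewrite -E ler_pM2r.
  have EC : C * `|y| = 2 * `|B + r| / c.
    by rewrite /C /c; field; rewrite !gt_eqF.
  rewrite EC -(ler_pM2l c0) mulrDr [X in _ <= _ + X]mulrC divfK ?gt_eqF//.
  have := ler_norm (B + r); lra.
have lC v : `|l v| <= C * `|v|.
  apply: (@lin_bound_of_affine D l C (Nb + Nb - val zb + r - l (diff zb)) ll) => {}v.
  have Ab : A (diff zb, Nb + Nb - val zb) by case: zbN => S T; exists zb, Nb, Nb.
  by have := lP _ (- v) Ab; rewrite /= opprK (linD ll) normrN; lra.
have [G GE] := bidual_of ll lC.
have [U UE] := bidualD_ex F G 1 1; have [V VE] := bidualD_ex G G (-1) 0.
exists U, V; split=> [f|z w s t Ss Tt]; first by rewrite UE VE; lra.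
have Azw : A (diff (z, w), s + t - val (z, w)) by exists (z, w), s, t.
have := lP _ 0 Azw; rewrite /= subr0 normr0 mulr0 addr0 (linB ll) UE VE -!GE /val /=; lra.
Qed.

End InteriorCondition.
End ConjugateSplitting.

(** * Splitting of the conjugate under the closedness condition *)

Section ClosednessCondition.
Variables (R : realType) (X : normedModType R).
Local Notation D := (dual X).

(** An affine minorant of value [r] at [z0], that is, biconjugation for the pairing with X^* x X^**.
    Near [z0] lower semicontinuity keeps h above [r]; farther away the quadratic term dominates the
    lower bound of the coupling. *)
Lemma affine_minorant (h : X * D -> \bar R) z0 (r : R) :
  convex_fun h -> nlsc h -> (forall z, ((coupling z)%:E <= h z)%E) ->
  (exists z s, (h z <= s%:E)%E) -> (r%:E < h z0)%E ->
  exists (a : D) (F : bidual X), forall z s, (h z <= s%:E)%E ->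
    a z.1 + F z.2 - s <= a z0.1 + F z0.2 - r.
Proof.
move=> hc hl hge [z1 [s1 hz1]] rh; have [e [e0 He]] := hl _ _ rh.
have e2 : 0 < e ^+ 2 by rewrite exprn_gt0.
pose A := (`|r| + `|z0.1| ^+ 2 + `|z0.2| ^+ 2) / e ^+ 2.
have A0 : 0 <= A by rewrite divr_ge0 ?addr_ge0 ?sqr_ge0.
have EA : e ^+ 2 * A = `|r| + `|z0.1| ^+ 2 + `|z0.2| ^+ 2.
  by rewrite /A mulrC divfK// gt_eqF.
pose C := 1 + A; have C0 : 0 <= C by rewrite /C; lra.
pose T (z : X * D) : R := `|z.1 - z0.1| ^+ 2 + `|z.2 - z0.2| ^+ 2.
have Tc : cvx_fun T.
  apply: cvx_funD; apply: cvx_fun_sqr => //=.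
    by apply: cvx_fun_norm => x y t; exact: (affine_subr fst).
  by apply: cvx_fun_norm => x y t; exact: (affine_subr snd).
have [||||z Hz|a [F aF]] := @sandwich_pair R X
    [set p : (X * D) * R | (h p.1 <= p.2%:E)%E] (fun z => C * T z) r.
- exact: epi_cvx.
- by exists (z1, s1).
- exact: cvx_funZ.
- move=> b; exists (C * ((`|b| + `|z0.1|) ^+ 2 + (`|b| + `|z0.2|) ^+ 2)) => w w1 w2.
  have b0 := le_trans (normr_ge0 _) w1; rewrite (ger0_norm b0).
  apply: ler_wpM2l => //; apply: lerD; apply: lerXn2r; rewrite ?nnegrE ?addr_ge0//.
    by apply: (le_trans (ler_normB _ _)); rewrite lerD2r.
  by apply: (le_trans (ler_normB _ _)); rewrite lerD2r.
- case: z Hz => z s /= hz; have T0 : 0 <= T z by rewrite addr_ge0 ?sqr_ge0.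
  have [Tlt|Tge] := ltP (T z) (e ^+ 2).
    have lt_e (x : R) : x ^+ 2 < e ^+ 2 -> x < e.
      move=> xe; rewrite ltNge; apply/negP => ex; move: xe; apply/negP; rewrite -leNgt.
      by apply: lerXn2r => //; rewrite nnegrE; lra.
    have n1 := sqr_ge0 `|z.1 - z0.1|; have n2 := sqr_ge0 `|z.2 - z0.2|.
    have /He : nclose z0 z e.
      by apply/ncloseP; split; rewrite distrC; apply: lt_e; move: Tlt; rewrite /T; lra.
    move=> /lt_le_trans/(_ hz); rewrite lte_fin => rs.
    by have := mulr_ge0 C0 T0; lra.
  have := rep_ge hge hz; have := pairing_amgm1 z.2 z.1.
  have sq (E : normedModType R) (x y : E) : `|x| ^+ 2 <= 2 * (`|y| ^+ 2 + `|x - y| ^+ 2).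
    have xy : `|x| <= `|y| + `|x - y| by rewrite addrC; have := ler_normD (x - y) y; rewrite subrK.
    have : `|x| ^+ 2 <= (`|y| + `|x - y|) ^+ 2 by apply: lerXn2r; rewrite ?nnegrE ?addr_ge0.
    have := sqr_ge0 (`|y| - `|x - y|); rewrite !expr2; lra.
  have := sq _ z.1 z0.1; have := sq _ z.2 z0.2.
  have : e ^+ 2 * A <= T z * A by apply: ler_wpM2r.
  rewrite EA /C; move: (ler_norm r); move: (`|r|) => r'.
  rewrite /T; lra.
exists a, F => z s hz; have := aF (z, s) z0 hz.
rewrite /T !subrr !normr0 !expr0n/= addr0 mulr0; lra.
Qed.

Lemma conj_split_sum (hS hT : X * D -> \bar R) (a b : D) (U V : bidual X) (r : R) :
  (forall z, ((coupling z)%:E <= hS z)%E) -> (forall z, ((coupling z)%:E <= hT z)%E) ->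
  (exists z s, (hS z <= s%:E)%E) -> (exists z s, (hT z <= s%:E)%E) ->
  (forall z w s t, (hS z <= s%:E)%E -> (hT w <= t%:E)%E ->
      (a z.1 + U z.2 - s) + (b w.1 + V w.2 - t) <= r) ->
  (conj_fun hS a U + conj_fun hT b V <= r%:E)%E.
Proof.
move=> Sge Tge [z0 [s0 S0]] [w0 [t0 T0]] H.
have SN z : hS z != -oo%E by have := Sge z; case: (hS z).
have TN z : hT z != -oo%E by have := Tge z; case: (hT z).
have S_le w t : (hT w <= t%:E)%E -> (conj_fun hS a U <= (r - (b w.1 + V w.2 - t))%:E)%E.
  by move=> Tw; apply: conj_fun_le => // z s Sz; have := H z w s t Sz Tw; lra.
have := S_le w0 t0 T0; have := conj_fun_ge a U S0.
case: (conj_fun hS a U) S_le => [A| |]// S_le _ _.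
suff : (conj_fun hT b V <= (r - A)%:E)%E.
  by move=> H2; rewrite -(subrKC A r) EFinD; apply: leeD.
apply: conj_fun_le => // w t Tw; have := S_le w t Tw; rewrite lee_fin; lra.
Qed.

Variables (hS hT : X * D -> \bar R).
Hypotheses (Sc : convex_fun hS) (Tc : convex_fun hT) (Sl : nlsc hS) (Tl : nlsc hT).
Hypotheses (Sge : forall z, ((coupling z)%:E <= hS z)%E)
  (Tge : forall z, ((coupling z)%:E <= hT z)%E).
Hypothesis dom_ne : pr_dual_dom hS `&` pr_dual_dom hT !=set0.

Let below (h : X * D -> \bar R) z : (forall z, ((coupling z)%:E <= h z)%E) ->
  exists r : R, (r%:E < h z)%E.
Proof.
by move=> hge; exists (coupling z - 1); apply: lt_le_trans (hge z); rewrite lte_fin; lra.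
Qed.

Let sum_le_real (x y : \bar R) (m : R) : (exists r : R, (r%:E < x)%E) ->
  (exists r : R, (r%:E < y)%E) ->
  (forall r1 r2 : R, (r1%:E < x)%E -> (r2%:E < y)%E -> r1 + r2 <= m) ->
  exists s t : R, [/\ x = s%:E, y = t%:E & s + t <= m].
Proof.
move=> [r1 xr1] [r2 yr2] H.
have fin (z : \bar R) (r M : R) : (r%:E < z)%E -> (forall r' : R, (r'%:E < z)%E -> r' <= M) ->
    exists s, z = s%:E.
  case: z => [s| |]// _ HM; first by exists s.
  by have := HM (M + 1) (ltry _); lra.
have [s xs] : exists s, x = s%:E.
  by apply: (fin x r1 (m - r2)) => // r' xr'; have := H r' r2 xr' yr2; lra.
have [t yt] : exists t, y = t%:E.
  by apply: (fin y r2 (m - r1)) => // r' yr'; have := H r1 r' xr1 yr'; lra.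
exists s, t; split=> //; apply/ler_addgt0Pr => e e0.
have := H (s - e / 2) (t - e / 2); rewrite xs yt !lte_fin => /(_ ltac:(lra) ltac:(lra)); lra.
Qed.

Let split_at (q : D * D * bidual X * R) := exists U V : bidual X,
  (forall f, q.1.2 f = U f + V f) /\
  forall z w s t, (hS z <= s%:E)%E -> (hT w <= t%:E)%E ->
    (q.1.1.1 z.1 + U z.2 - s) + (q.1.1.2 w.1 + V w.2 - t) <= q.2.

Let base : exists u w (b : D) (s t : R), (hS (u, b) <= s%:E)%E /\ (hT (w, b) <= t%:E)%E.
Proof.
have [b [[u /lt_pinfty_real[s hs]] [w /lt_pinfty_real[t ht]]]] := dom_ne.
by exists u, w, b, s, t.
Qed.

Let split_condb q : split_at q -> condb_set hS hT q.
Proof.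
move=> [U [V [UV H]]]; exists U, V; split=> //.
have [u [w [b [s [t [Ss Tt]]]]]] := base.
by apply: conj_split_sum => //; [exists (u, b), s|exists (w, b), t].
Qed.

Let split_minorant z w (r1 r2 : R) : (r1%:E < hS z)%E -> (r2%:E < hT w)%E ->
  exists q, split_at q /\ exists U V : bidual X, (forall f, q.1.2 f = U f + V f) /\
    q.2 = (q.1.1.1 z.1 + U z.2 - r1) + (q.1.1.2 w.1 + V w.2 - r2).
Proof.
move=> zr wr; have [u0 [w0 [b0 [s0 [t0 [Ss Tt]]]]]] := base.
have [|a [U aU]] := affine_minorant Sc Sl Sge _ zr; first by exists (u0, b0), s0.
have [|b [V bV]] := affine_minorant Tc Tl Tge _ wr; first by exists (w0, b0), t0.
have [G GE] := bidualD_ex U V 1 1; have {}GE f : G f = U f + V f by rewrite GE; lra.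
exists (a, b, G, (a z.1 + U z.2 - r1) + (b w.1 + V w.2 - r2)); split.
  exists U, V; split=> //= z' w' s t Sz Tw; apply: lerD; [exact: aU|exact: bV].
by exists U, V.
Qed.

(* A separating functional whose [R]-coefficient [s] is nonpositive, possibly zero, is
   tilted by a large multiple [k] of it against a common point of the domains. *)
Let no_separation (a : D) (F : bidual X) (r e s : R) (x1 x2 : X) (f : D) :
  conj_bounded hS hT a F r -> 0 < e -> s <= 0 ->
  ~ forall q, split_at q -> q.1.1.1 x1 + q.1.1.2 x2 + q.1.2 f + s * q.2
     <= a x1 + a x2 + F f + s * r - e.
Proof.
move=> Hr e0 s0 Hsep; have [u0 [w0 [b0 [su [tw [Ss Tt]]]]]] := base.
pose K := a u0 + a w0 + F b0 - su - tw.
pose k := (`|r + 1 - K| + 1) / e.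
have k0 : 0 < k by rewrite divr_gt0// ltr_pwDr.
have ke : k * e = `|r + 1 - K| + 1 by rewrite divfK// gt_eqF.
pose d := 1 - k * s; have d0 : 0 < d.
  by rewrite /d; have := mulr_ge0_le0 (ltW k0) s0; lra.
have dN : d != 0 by rewrite gt_eqF.
pose z : X * D := (d^-1 *: (u0 + k *: x1), d^-1 *: (b0 + k *: f)).
pose w : X * D := (d^-1 *: (w0 + k *: x2), d^-1 *: (b0 + k *: f)).
pose M := (su + tw + k * (a x1 + a x2 + F f + s * r - e)) / d.
(* Each pair of affine minorants below hS(z) and hT(w) gives a point of [split_at], so the
   separation bounds hS(z) + hT(w) by [M]. This contradicts [conj_bounded] at [z] and [w], because k
   e > r - K. *)
have [||r1 r2 zr wr|S1 [S2 [hz hw S12]]] := @sum_le_real (hS z) (hT w) M.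
- exact: below.
- exact: below.
- have [q [Eq [U [V [UV qE]]]]] := split_minorant zr wr.
  have Hq := Hsep q Eq; have [U' [V' [UV' Hq']]] := Eq.
  have := Hq' _ _ _ _ Ss Tt; rewrite /= => Hb.
  have Gb : U' b0 + V' b0 = U b0 + V b0 by rewrite -UV' UV.
  have key : k * (q.1.1.1 x1 + q.1.1.2 x2 + q.1.2 f + s * q.2)
      <= k * (a x1 + a x2 + F f + s * r - e) by rewrite ler_pM2l.
  have dq : d * q.2 = q.1.1.1 (u0 + k *: x1) + U (b0 + k *: f)
      + q.1.1.2 (w0 + k *: x2) + V (b0 + k *: f) - d * (r1 + r2).
    rewrite qE /z /w /= !(linZ (dval_lin _)) !(linZ (bidual_lin _)).
    by rewrite -[X in _ = X - _]mul1r -(mulfV dN); ring.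
  move: dq; rewrite !(linD (dval_lin _)) !(linZ (dval_lin _)).
  rewrite !(linD (bidual_lin _)) !(linZ (bidual_lin _)) => dq.
  rewrite /M ler_pdivlMr// mulrC; move: key dq; rewrite UV /d; lra.
have := Hr _ _ _ _ _ (_ : (hS (z.1, z.2) <= S1%:E)%E) (_ : (hT (w.1, z.2) <= S2%:E)%E).
rewrite -surjective_pairing hz (_ : (w.1, z.2) = w)// hw !lexx => /(_ isT isT).
rewrite -(ler_pM2l d0) mulrBr /z /w /= (linD (dval_lin a)) !(linZ (dval_lin a)) (linZ (bidual_lin F)).
rewrite -mulrDr -mulrDr mulVKf// !(linD (dval_lin a)) !(linZ (dval_lin a)).
rewrite (linD (bidual_lin F)) (linZ (bidual_lin F)).
have : d * (S1 + S2) <= d * M by rewrite ler_pM2l.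
rewrite [d * M]mulrC /M divfK// /d; have := ler_norm (r + 1 - K); rewrite /K in ke *; lra.
Qed.

Lemma closed_conj_split (a : D) (F : bidual X) (r : R) :
  closed_regarding (condb_set hS hT) (@diag_set R X) ->
  conj_bounded hS hT a F r -> conj_split hS hT a F r.
Proof.
move=> cl Hr; pose p := (a, a, F, r).
suff cp : wstar_closure (condb_set hS hT) p.
  have : (wstar_closure (condb_set hS hT) `&` @diag_set R X) p by split.
  rewrite cl => -[[U [V [UV Hle]]] _]; exists U, V; split=> [f|z w s t Sz Tw].
    by rewrite -UV.
  rewrite -lee_fin EFinD; apply: le_trans Hle.
  by apply: leeD; exact: conj_fun_ge.
move=> n xs fs e e0; apply: contrapT => Hn.
pose I := (('I_n + 'I_n) + ('I_n + unit))%type.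
pose ev (q : D * D * bidual X * R) (i : I) : R := match i with
  | inl (inl k) => q.1.1.1 (xs k) | inl (inr k) => q.1.1.2 (xs k)
  | inr (inl k) => q.1.2 (fs k) | inr (inr _) => q.2 end.
have [||c cP] := @finite_separation R I [set v | exists2 q, split_at q & v = ev q] (ev p) e e0.
- move=> _ _ t [q [U [V [UV Hq]]] ->] [q' [U' [V' [UV' Hq']]] ->] /andP[t0 t1].
  have [G GE] := bidualD_ex q.1.2 q'.1.2 t (1 - t).
  have [U1 U1E] := bidualD_ex U U' t (1 - t); have [V1 V1E] := bidualD_ex V V' t (1 - t).
  exists (t *: q.1.1.1 + (1 - t) *: q'.1.1.1, t *: q.1.1.2 + (1 - t) *: q'.1.1.2, G,
    t * q.2 + (1 - t) * q'.2).
    exists U1, V1; split=> [f|z w s s' Sz Tw] /=; first by rewrite GE UV UV' U1E V1E; ring.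
    have t1' : 0 <= 1 - t by lra.
    have := ler_wpM2l (ltW t0) (Hq _ _ _ _ Sz Tw).
    have := ler_wpM2l t1' (Hq' _ _ _ _ Sz Tw); rewrite U1E V1E /=; lra.
  by apply/funext => -[[k|k]|[k|[]]] //=; rewrite GE.
- move=> _ [q Eq ->]; apply: contrapT => Hi; apply: Hn; exists q; split.
    exact: split_condb.
  have lt_e i : `|ev p i - ev q i| < e.
    by rewrite distrC ltNge; apply/negP => ei; apply: Hi; exists i.
  split; last exact: (lt_e (inr (inr tt))).
  move=> k; split; first exact: (lt_e (inl (inl k))).
  by split; [exact: (lt_e (inl (inr k)))|exact: (lt_e (inr (inl k)))].
pose x1 := \sum_k c (inl (inl k)) *: xs k; pose x2 := \sum_k c (inl (inr k)) *: xs k.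
pose f := \sum_k c (inr (inl k)) *: fs k; pose s := c (inr (inr tt)).
have evE q : \sum_i c i * ev q i = q.1.1.1 x1 + q.1.1.2 x2 + q.1.2 f + s * q.2.
  rewrite !big_sumType /= (lin_sum (dval_lin _)) (lin_sum (dval_lin _)) (lin_sum (bidual_lin _)).
  by rewrite (bigD1 tt)//= [X in s * _ + X]big1 ?addr0 ?addrA// => -[].
have sep q : split_at q -> q.1.1.1 x1 + q.1.1.2 x2 + q.1.2 f + s * q.2
    <= a x1 + a x2 + F f + s * r - e.
  by move=> Eq; rewrite -evE; have := cP (ev q); rewrite (evE p); apply; exists q.
(* The last coordinate of a point of [split_at] may be increased freely, so its coefficient cannot
   be positive. *)
apply: (no_separation Hr e0 _ sep).
rewrite leNgt; apply/negP => s0.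
have [r1 zr1] := below (0, 0) Sge; have [r2 zr2] := below (0, 0) Tge.
have [[[[b b'] G] m] [Eq _]] := split_minorant zr1 zr2.
pose B := a x1 + a x2 + F f + s * r - e - (b x1 + b' x2 + G f + s * m).
have Eq' : split_at (b, b', G, m + (`|B| + 1) / s).
  have [U [V [UV H]]] := Eq; exists U, V; split=> // z w s' t' Sz Tw.
  apply: le_trans (H _ _ _ _ Sz Tw) _ => /=.
  by rewrite lerDl divr_ge0 ?ltW// ltr_pwDr.
have := sep _ Eq'; rewrite /= mulrDr (mulrC s ((_ + _) / s)) divfK ?gt_eqF//.
have := ler_norm B; rewrite /B; lra.
Qed.

End ClosednessCondition.

(** * Norm closure of a function above the coupling *)

Section NormClosure.
Variables (R : realType) (X : normedModType R).
Local Notation D := (dual X).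
Implicit Types (k : X * D -> \bar R) (z w : X * D).

Lemma nclosure_le k z (r : R) : (k z <= r%:E)%E -> (nclosure k z <= r%:E)%E.
Proof.
move=> kz; apply: ereal_inf_lbound; exists r => // e e0; exists z; split.
  by apply/ncloseP; rewrite !subrr !normr0.
by apply: le_lt_trans kz _; rewrite lte_fin ltrDl.
Qed.

Lemma nclosure_ge_coupling k : (forall z, ((coupling z)%:E <= k z)%E) ->
  forall z, ((coupling z)%:E <= nclosure k z)%E.
Proof.
move=> kge z; apply: le_ereal_inf_tmp => _ [r Hr <-]; rewrite lee_fin.
apply/ler_addgt0Pr => e e0.
have B0 : 0 < `|z.2| + `|z.1| + 2.
  by have := normr_ge0 z.1; have := normr_ge0 z.2; lra.
pose t := Num.min 1 (e / (`|z.2| + `|z.1| + 2)).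
have t0 : 0 < t by rewrite lt_min ltr01 divr_gt0.
have [t1 te] : t <= 1 /\ t * (`|z.2| + `|z.1| + 2) <= e.
  by rewrite -ler_pdivlMr ?ge_min ?lexx ?orbT.
have [w [/ncloseP[w1 w2] kw]] := Hr t t0.
have := le_lt_trans (kge w) kw; rewrite lte_fin /coupling.
have := dual_dist (ltW w1) (ltW w2); rewrite ler_norml => /andP[_].
have : t * t <= t by rewrite ler_piMr// ltW.
lra.
Qed.

Lemma nclosure_nlsc k : nlsc (nclosure k).
Proof.
move=> z r rz.
have [r1 rr1 r1z] : exists2 r1 : R, r < r1 & (r1%:E < nclosure k z)%E.
  case: (nclosure k z) rz => [s| |]//; last by exists (r + 1); rewrite ?ltry ?ltrDl.
  by rewrite lte_fin => rs; exists ((r + s) / 2); rewrite ?lte_fin; lra.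
have [e e0 He] : exists2 e, 0 < e & forall w, nclose z w e -> ((r1 + e)%:E <= k w)%E.
  apply: contrapT => H; move: r1z; rewrite ltNge => /negP; apply.
  apply: ereal_inf_lbound; exists r1 => // e e0; apply: contrapT => Hw.
  apply: H; exists e => // w zw; rewrite leNgt; apply/negP => kw.
  by apply: Hw; exists w.
have e2 : 0 < e / 2 by lra.
exists (e / 2); split=> // w /ncloseP[zw1 zw2].
apply: (@lt_le_trans _ _ r1%:E); first by rewrite lte_fin.
apply: le_ereal_inf_tmp => _ [s Hs <-]; rewrite lee_fin.
have [v [/ncloseP[wv1 wv2] kv]] := Hs _ e2.
have /He : nclose z v e.
  apply/ncloseP; have := ler_distD w.1 z.1 v.1; have := ler_distD w.2 z.2 v.2.
  by split; lra.
by move=> /le_lt_trans/(_ kv); rewrite lte_fin; lra.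
Qed.

(** Convexity is assumed through strict upper bounds because the infimum in [infconv1] need not be
    attained; the coupling excludes the value -oo. *)
Lemma nclosure_convex k :
  (forall z w (r s t : R), (k z < r%:E)%E -> (k w < s%:E)%E -> 0 < t < 1 ->
    (k (t *: z + (1 - t) *: w)%R < (t * r + (1 - t) * s)%:E)%E) ->
  (forall z, ((coupling z)%:E <= k z)%E) -> convex_fun (nclosure k).
Proof.
move=> kc kge z1 z2 z t t01 z1E z2E.
have {z1E z2E} -> : z = t *: z1 + (1 - t) *: z2.
  by case: z z1E z2E => x f /= -> fE; congr pair; exact: dual_ext.
have := nclosure_ge_coupling kge z1; have := nclosure_ge_coupling kge z2.
have [t0 t1] := andP t01; have t1' : 0 < 1 - t by lra.
case E1 : (nclosure k z1) => [A1| |]//; last first.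
  rewrite gt0_muley ?lte_fin//; case: (nclosure k z2) => [s| |]// _ _.
    by rewrite leey.
  by rewrite gt0_muley ?lte_fin// leey.
case E2 : (nclosure k z2) => [A2| |]// _ _; last by rewrite gt0_muley ?lte_fin// leey.
apply/lee_addgt0Pr => e e0.
have lt1 : (nclosure k z1 < (A1 + e)%:E)%E by rewrite E1 lte_fin ltrDl.
have lt2 : (nclosure k z2 < (A2 + e)%:E)%E by rewrite E2 lte_fin ltrDl.
have [_ [r1 H1 <-]] := ereal_inf_lt lt1; rewrite lte_fin => r1A.
have [_ [r2 H2 <-]] := ereal_inf_lt lt2; rewrite lte_fin => r2A.
apply: (@le_trans _ _ (t * r1 + (1 - t) * r2)%:E).
  apply: ereal_inf_lbound; exists (t * r1 + (1 - t) * r2) => // d d0.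
  have [w1 [/ncloseP[w11 w12] kw1]] := H1 d d0; have [w2 [/ncloseP[w21 w22] kw2]] := H2 d d0.
  exists (t *: w1 + (1 - t) *: w2); split; last first.
    apply: lt_le_trans (kc _ _ _ _ _ kw1 kw2 t01) _; rewrite lee_fin; lra.
  have comb (E : normedModType R) (x1 x2 y1 y2 : E) : `|x1 - y1| < d -> `|x2 - y2| < d ->
      `|t *: x1 + (1 - t) *: x2 - (t *: y1 + (1 - t) *: y2)| < d.
    move=> h1 h2; rewrite opprD addrACA -!scalerBr.
    apply: le_lt_trans (ler_normD _ _) _; rewrite !normrZ (gtr0_norm t0) (gtr0_norm t1').
    have := ler_wpM2l (ltW t1') (ltW h2); have : t * `|x1 - y1| < t * d by rewrite ltr_pM2l.
    lra.
  by apply/ncloseP; split; exact: comb.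
rewrite -!EFinM -!EFinD lee_fin.
have := ler_wpM2l (ltW t0) (ltW r1A); have := ler_wpM2l (ltW t1') (ltW r2A); lra.
Qed.

End NormClosure.

(** * Infimal convolution in the first variable *)

Section InfimalConvolution.
Variables (R : realType) (X : normedModType R) (hS hT : X * dual X -> \bar R).
Local Notation D := (dual X).
Hypotheses (Sc : convex_fun hS) (Tc : convex_fun hT).
Hypotheses (Sge : forall z, ((coupling z)%:E <= hS z)%E)
  (Tge : forall z, ((coupling z)%:E <= hT z)%E).

Lemma infconv1_le u w (b : D) (s t : R) : (hS (u, b) <= s%:E)%E -> (hT (w, b) <= t%:E)%E ->
  (infconv1 hS hT (u + w, b)%R <= (s + t)%:E)%E.
Proof.
move=> Ss Tt; apply: (@le_trans _ _ (hS (u, b) + hT (w, b))%E).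
  by apply: ereal_inf_lbound; exists u, w.
by rewrite EFinD; exact: leeD.
Qed.

Lemma infconv1_lt (z : X * D) (r : R) : (infconv1 hS hT z < r%:E)%E ->
  exists u w (s t : R), [/\ u + w = z.1, (hS (u, z.2) <= s%:E)%E,
    (hT (w, z.2) <= t%:E)%E & s + t < r].
Proof.
move=> /ereal_inf_lt[_ [u [w [uw ->]]]].
have := Sge (u, z.2); have := Tge (w, z.2).
case S : (hS (u, z.2)) => [s| |]//; case T : (hT (w, z.2)) => [t| |]// _ _.
by rewrite -EFinD lte_fin => st; exists u, w, s, t; rewrite S T !lexx.
Qed.

Lemma infconv1_ge z : ((coupling z)%:E <= infconv1 hS hT z)%E.
Proof.
rewrite leNgt; apply/negP => /infconv1_lt[u [w [s [t [uw Ss Tt]]]]].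
have := rep_ge Sge Ss; have := rep_ge Tge Tt; rewrite /coupling -uw (linD (dval_lin _)) /=; lra.
Qed.

Lemma infconv1_cvx_lt (z w : X * D) (r s t : R) : (infconv1 hS hT z < r%:E)%E ->
  (infconv1 hS hT w < s%:E)%E -> 0 < t < 1 ->
  (infconv1 hS hT (t *: z + (1 - t) *: w)%R < (t * r + (1 - t) * s)%:E)%E.
Proof.
case: z w => [z a] [w b].
move=> /infconv1_lt[u1 [w1 [s1 [t1 [/= <- S1 T1 r1]]]]].
move=> /infconv1_lt[u2 [w2 [s2 [t2 [/= <- S2 T2 r2]]]]] t01.
have S3 := @epi_cvx R X hS Sc (u1, a, s1) (u2, b, s2) t S1 S2 t01.
have T3 := @epi_cvx R X hT Tc (w1, a, t1) (w2, b, t2) t T1 T2 t01.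
have := infconv1_le S3 T3.
rewrite -[X in infconv1 _ _ (X, _)]/(t *: u1 + (1 - t) *: u2 + (t *: w1 + (1 - t) *: w2)).
rewrite addrACA -!scalerDr => /le_lt_trans; apply; rewrite lte_fin.
suff : t * s1 + (1 - t) * s2 + (t * t1 + (1 - t) * t2) < t * r + (1 - t) * s by [].
have [t0 t1'] := andP t01.
have : t * (s1 + t1) < t * r by rewrite ltr_pM2l.
have : (1 - t) * (s2 + t2) < (1 - t) * s by rewrite ltr_pM2l ?subr_gt0.
lra.
Qed.

End InfimalConvolution.

(** * The extended parallel sum and its representative *)

Section ParallelSum.
Variables (R : realType) (X : normedModType R).
Local Notation D := (dual X).

(** The point [p] is tested against a net in [G] converging to [q]; boundedness of the net makes its
    couplings converge to [q.1 q.2]. *)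
Lemma gossez_monotone (G : set (X * D)) (p q : bidual X * D) : gossez_D G ->
  gossez G p -> gossez G q -> 0 <= p.1 p.2 - p.1 q.2 - q.1 p.2 + q.1 q.2.
Proof.
move=> [_ GD] Gp /GD[I [le [net [_ [lexx_ [_ [_ [Gnet [[B HB] Hnet]]]]]]]]].
have [M M0 pM] := bidual_bound p.1; apply/ler_addgt0Pr => e e0.
(* Errors in units of [d]: [M] from [p.1 w.2], 1 from each functional tested on [w.1], and |B| from
   [w.2 - q.2] on [w.1]. *)
pose N := M + 2 + `|B|.
have N0 : 0 < N by have := normr_ge0 B; rewrite /N; lra.
have d0 : 0 < e / N by rewrite divr_gt0.
have dN : e / N * N = e by rewrite divfK// gt_eqF.
have [i0 /(_ i0 (lexx_ i0))[]] := Hnet 2%N (fun k => if k == ord0 then p.2 else q.2) _ d0.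
set d := e / N in d0 dN *; move=> Hf [K [Kd HK]].
have := Hf ord0; have := Hf (lift ord0 ord0); rewrite /= => fq fp.
have [n1 _] := HB i0; have Gi := Gp _ (Gnet i0).
move: n1 Gi fp fq HK; set w := net i0 => n1 Gi fp fq HK.
have w2 : `|w.2 - q.2| <= d.
  apply: dual_norm_le => [|x]; first exact: ltW.
  rewrite dualBE; apply: (le_trans (HK x)); rewrite ler_wpM2r//; exact: ltW.
have h1 : `|p.1 w.2 - p.1 q.2| <= M * d.
  by rewrite -(linB (bidual_lin _)); apply: (le_trans (pM _)); rewrite ler_wpM2l// ltW.
have h2 : `|w.2 w.1 - q.2 w.1| <= d * `|B|.
  rewrite -dualBE; apply: (le_trans (dual_bound _ _)).
  by apply: ler_pM => //; apply: (le_trans n1); exact: ler_norm.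
move: h1 h2 fp fq; rewrite !ler_norml !ltr_norml => /andP[h1 _] /andP[_ h2] /andP[fp _] /andP[_ fq].
rewrite -dN /N; lra.
Qed.

Lemma canon_gossez (G : set (X * D)) (F : bidual X) x (a : D) :
  is_canon F x -> maximal_monotone G -> gossez G (F, a) -> G (x, a).
Proof.
move=> Fx [_ Gmax] Ga; apply: Gmax => w Gw; have := Ga w Gw; rewrite /= !Fx; lra.
Qed.

Lemma gossez_canon (G : set (X * D)) (F : bidual X) x (a : D) :
  is_canon F x -> Defs.monotone G -> G (x, a) -> gossez G (F, a).
Proof.
move=> Fx Gm Ga w Gw; have := Gm _ _ Ga Gw; rewrite /= !Fx; lra.
Qed.

Lemma bar_par_sumC (GS GT : set (X * D)) : bar_par_sum GS GT = bar_par_sum GT GS.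
Proof.
by apply/seteqP; split=> z [U [W [UW [hU hW]]]]; exists W, U; split=> // f; rewrite addrC.
Qed.

Lemma par_sumC (GS GT : set (X * D)) : par_sum GS GT = par_sum GT GS.
Proof.
by apply/seteqP; split=> z [u [w [uw [hu hw]]]]; exists w, u; split=> //; rewrite addrC.
Qed.

(** If one summand of [z.1] is canonical, so is the other, being a difference; maximality turns
    canonical points of the closure into points of the graph. *)
Lemma par_sum_bar (GS GT : set (X * D)) : maximal_monotone GS -> maximal_monotone GT ->
  gossez_dom_in_X GS -> par_sum GS GT = bar_par_sum GS GT.
Proof.
move=> Sm Tm Sdom; apply/seteqP; split=> [z [u [w [uw [Su Tw]]]]|z [U [W [UW [Sz Tz]]]]].
  have [U HU] := canon_ex u; have [W HW] := canon_ex w.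
  exists U, W; split; first by move=> f; rewrite HU HW -(linD (dval_lin _)) uw.
  by split; [exact: gossez_canon HU Sm.1 Su|exact: gossez_canon HW Tm.1 Tw].
have [x /= Ux] := Sdom _ Sz; exists x, (z.1 - x); split; first by rewrite addrC subrK.
split; first exact: canon_gossez Ux Sm Sz.
apply: canon_gossez Tm Tz => f; rewrite (linB (dval_lin _)) -UW Ux; lra.
Qed.

Variables (GS GT : set (X * D)) (hS hT : X * D -> \bar R).
Hypotheses (SD : gossez_D GS) (TD : gossez_D GT).
Hypotheses (Srep : strong_representative GS hS) (Trep : strong_representative GT hT).
Hypothesis Xc : geo_complete X.
Hypothesis split_conj : forall (a : D) (F : bidual X) (r : R),
  conj_bounded hS hT a F r -> conj_split hS hT a F r.

Let h := nclosure (infconv1 hS hT).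

Let Sge z : ((coupling z)%:E <= hS z)%E. Proof. by case: Srep => -[]. Qed.
Let Tge z : ((coupling z)%:E <= hT z)%E. Proof. by case: Trep => -[]. Qed.

(** The strong property of [hT] eliminates the second summand, whose supremum is at least [V a]. *)
Let split_le (a : D) (U V : bidual X) (r : R) z s : (hS z <= s%:E)%E ->
  (forall z w s t, (hS z <= s%:E)%E -> (hT w <= t%:E)%E ->
      (a z.1 + U z.2 - s) + (a w.1 + V w.2 - t) <= r) ->
  a z.1 + U z.2 - s <= r - V a.
Proof.
move=> Sz H.
suff : V a <= r - (a z.1 + U z.2 - s) by lra.
by apply: (strong_rep_le Tge Trep.2) => w t Tw; have := H z w s t Sz Tw; lra.
Qed.

Let h_le u w (b : D) (s t : R) : (hS (u, b) <= s%:E)%E -> (hT (w, b) <= t%:E)%E ->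
  (h (u + w, b)%R <= (s + t)%:E)%E.
Proof. by move=> Ss Tt; apply/nclosure_le/infconv1_le. Qed.

Let h_convex : convex_fun h.
Proof.
have [[Sc _ _ _] _] := Srep; have [[Tc _ _ _] _] := Trep.
by apply: nclosure_convex; [exact: infconv1_cvx_lt|exact: infconv1_ge].
Qed.

Let h_ge z : ((coupling z)%:E <= h z)%E.
Proof. by apply: nclosure_ge_coupling; exact: infconv1_ge. Qed.

Let h_strong (a : D) (F : bidual X) : ((F a)%:E <= conj_fun h a F)%E.
Proof.
rewrite leNgt; apply/negP => lt.
have [r hr rF] : exists2 r : R, (conj_fun h a F <= r%:E)%E & r < F a.
  case: (conj_fun h a F) lt => [r| |]//; first by rewrite lte_fin => lt; exists r.
  by move=> _; exists (F a - 1); rewrite ?leNye//; lra.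
have [|U [V [UV H]]] := @split_conj a F r.
  move=> u w b s t Ss Tt; rewrite -lee_fin; apply: le_trans hr.
  exact: (@conj_fun_ge R X h a F (u + w, b) _ (h_le Ss Tt)).
have : U a <= r - V a.
  by apply: (strong_rep_le Sge Srep.2) => z s Sz; exact: (split_le Sz H).
by have := UV a; lra.
Qed.

(** At a contact point hS^*(z.2, U) + hT^*(z.2, V) <= c(z) = U z.2 + V z.2, while each conjugate is
    at least its own coupling. Both are therefore equalities, which tested on the graphs are the
    [gossez] inequalities. *)
Let contact_bar : contact h `<=` bar_par_sum GS GT.
Proof.
move=> z Mz; have [F HF] := canon_ex z.1.
have [|U [V [UV H]]] := @split_conj z.2 F (z.2 z.1).
  move=> u w b s t Ss Tt.
  have := touching_subgradient h_convex h_ge Mz (h_le Ss Tt); rewrite /= HF; lra.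
exists U, V; split; first by move=> f; rewrite UV HF.
have Uz := UV z.2; rewrite HF in Uz; split=> y Gy /=.
  have Sy : (hS y <= (y.2 y.1)%:E)%E by case: Srep => -[_ _ _ /(_ y Gy) ->].
  by have := split_le Sy H; lra.
have Ty : (hT y <= (y.2 y.1)%:E)%E by case: Trep => -[_ _ _ /(_ y Gy) ->].
suff : U z.2 <= z.2 z.1 - (z.2 y.1 + V y.2 - y.2 y.1) by lra.
by apply: (strong_rep_le Sge Srep.2) => w s Sw; have := H w y s _ Sw Ty; lra.
Qed.

Let bar_monotone : Defs.monotone (bar_par_sum GS GT).
Proof.
move=> z w [U [W [UW [zS zT]]]] [U' [W' [UW' [wS wT]]]].
have := gossez_monotone SD zS wS; have := gossez_monotone TD zT wT => /=.
have := UW z.2; have := UW w.2; have := UW' z.2; have := UW' w.2; lra.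
Qed.

Lemma bar_par_sum_contact : bar_par_sum GS GT = contact h.
Proof.
apply/seteqP; split=> [z zbar|]; last exact: contact_bar.
have [_ Mmax] := contact_maximal h_convex (@nclosure_nlsc _ _ _) h_ge h_strong Xc.
by apply: Mmax => w Mw; apply: bar_monotone => //; exact: contact_bar.
Qed.

Lemma bar_par_sum_strong_rep :
  strong_representative (bar_par_sum GS GT) h /\ gossez_D (bar_par_sum GS GT).
Proof.
rewrite bar_par_sum_contact; split; last first.
  by apply: contact_gossez_D => //; exact: nclosure_nlsc.
by split; [split=> //; exact: nclosure_nlsc|exact: h_strong].
Qed.

End ParallelSum.

Theorem theorem4p1 (R : realType) (X : completeNormedModType R)
  (GS GT : set (X * dual X)) (hS hT : X * dual X -> \bar R) :
  (exists x : X, x != 0) ->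
  gossez_D GS -> gossez_D GT ->
  strong_representative GS hS -> strong_representative GT hT ->
  pr_dual_dom hS `&` pr_dual_dom hT !=set0 ->
  (ic (dset_diff (pr_dual_dom hS) (pr_dual_dom hT)) (fun _ => 0)
   \/ closed_regarding (condb_set hS hT) (@diag_set R X)) ->
  (strong_representative (bar_par_sum GS GT) (nclosure (infconv1 hS hT))
   /\ gossez_D (bar_par_sum GS GT))
  /\ ((gossez_dom_in_X GS \/ gossez_dom_in_X GT) ->
      strong_representative (par_sum GS GT) (nclosure (infconv1 hS hT))
      /\ gossez_D (par_sum GS GT)).
Proof.
move=> _ SD TD Srep Trep dom_ne cond.
have Xc : geo_complete X by exact: complete_geo.
have [[Sc Sl Sge _] _] := Srep; have [[Tc Tl Tge _] _] := Trep.
have split_conj a F r : conj_bounded hS hT a F r -> conj_split hS hT a F r.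
  by case: cond => [dom_ic|cl]; [exact: interior_conj_split|exact: closed_conj_split].
have bar := bar_par_sum_strong_rep SD TD Srep Trep Xc split_conj; split=> // dom.
suff -> : par_sum GS GT = bar_par_sum GS GT by [].
case: dom => dom; first exact: par_sum_bar SD.1 TD.1 dom.
by rewrite par_sumC bar_par_sumC; exact: par_sum_bar TD.1 SD.1 dom.
Qed.
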